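(* Let $R=[a,b]\times[c,d]$, $2\le\beta\le3$ and $f\in\mathcal{C}(R)$. Then for every $\epsilon>0$ there exists $g\in\mathcal{S}_\beta$ such that $$g(\boldsymbol{x})\le f(\boldsymbol{x})\ \text{ for all }\boldsymbol{x}\in R\quad\text{and}\quad\|f-g\|_\infty<\epsilon.$$
   Context: $a<b$ and $c<d$ are real numbers. $\mathcal{C}(R)$ is the space of continuous functions $R\to\mathbb{R}$ with supremum norm $\|\cdot\|_\infty$. $\mathcal{S}_\beta:=\{g\in\mathcal{C}(R):\dim(Gr(g))=\beta\}$, where $Gr(g)\subset\mathbb{R}^3$ is the graph of $g$ and $\dim$ is any one (fixed) of the Hausdorff, box or packing dimensions. *)

(* Defs.v *)
From HB Require Import structures.
From mathcomp Require Import all_boot all_order all_algebra.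
From mathcomp Require Import all_classical all_reals all_analysis.
Set Implicit Arguments.
Unset Strict Implicit.
Unset Printing Implicit Defensive.
Import Order.TTheory GRing.Theory Num.Theory.
Import numFieldNormedType.Exports.
Local Open Scope classical_set_scope.
Local Open Scope ring_scope.

(* The norm of the normedModType 'rV[R]_n is the max norm, so it does not give
   the Euclidean distance. *)
Definition edist (R : realType) (n : nat) (x y : 'rV[R]_n) : R :=
  Num.sqrt (\sum_(i < n) (x 0 i - y 0 i) ^+ 2).

(* The maximum with 0 only serves to give the empty set diameter 0. *)
Definition diam (R : realType) (n : nat) (A : set 'rV[R]_n) : \bar R :=
  maxe 0%E (ereal_sup [set (edist p.1 p.2)%:E | p in A `*` A]).

Definition ecball (R : realType) (n : nat) (x : 'rV[R]_n) (r : R) :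
    set 'rV[R]_n :=
  [set y | edist x y <= r].

(* |A|^s. The empty set has weight 0 even for s = 0, so that a finite family
   can be written as a sequence that is eventually empty. *)
Definition diam_pow (R : realType) (n : nat) (s : R) (A : set 'rV[R]_n) :
    \bar R :=
  if `[< A = set0 >] then 0%E else poweR (diam A) s.

Definition delta_cover (R : realType) (n : nat) (delta : R)
    (A : set 'rV[R]_n) (U : nat -> set 'rV[R]_n) : Prop :=
  (forall i, (diam (U i) <= delta%:E)%E) /\ A `<=` \bigcup_i U i.

Definition hausdorff_premeasure (R : realType) (n : nat) (s delta : R)
    (A : set 'rV[R]_n) : \bar R :=
  ereal_inf [set (\sum_(0 <= i <oo) diam_pow s (U i))%E
            | U in [set U | delta_cover delta A U]].

(* The premeasure is nonincreasing in delta: the limit at 0 is a supremum. *)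
Definition hausdorff_measure (R : realType) (n : nat) (s : R)
    (A : set 'rV[R]_n) : \bar R :=
  ereal_sup [set hausdorff_premeasure s delta A
            | delta in [set delta : R | 0 < delta]].

Definition hausdorff_dim (R : realType) (n : nat) (A : set 'rV[R]_n) :
    \bar R :=
  ereal_inf [set s%:E | s in [set s : R | 0 <= s /\
                                          hausdorff_measure s A = 0%E]].

(* Least number of sets of diameter at most delta that cover A
   (+oo when no finite family does). *)
Definition covering_number (R : realType) (n : nat) (delta : R)
    (A : set 'rV[R]_n) : \bar R :=
  ereal_inf [set (k%:R)%:E | k in
    [set k : nat | exists U : 'I_k -> set 'rV[R]_n,
      (forall i, (diam (U i) <= delta%:E)%E) /\ A `<=` \bigcup_i U i]].

(* The box dimension is a relation, because the limit that defines it need not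
   exist (lower and upper box dimensions may differ). *)
Definition has_box_dim (R : realType) (n : nat) (A : set 'rV[R]_n)
    (beta : \bar R) : Prop :=
  (lne (covering_number delta A) * ((- ln delta)^-1)%:E)%E
    @[delta --> (0 : R)^'+] --> beta.

(* A finite or countable family of pairwise disjoint closed balls, indexed by
   I, with centres in A and radii at most delta. *)
Definition delta_packing (R : realType) (n : nat) (delta : R)
    (A : set 'rV[R]_n) (I : set nat) (x : nat -> 'rV[R]_n) (r : nat -> R) :
    Prop :=
  (forall i, I i -> A (x i) /\ 0 < r i <= delta) /\
  trivIset I (fun i => ecball (x i) (r i)).

Definition packing_delta (R : realType) (n : nat) (s delta : R)
    (A : set 'rV[R]_n) : \bar R :=
  ereal_sup [set t | exists (I : set nat) (x : nat -> 'rV[R]_n) (r : nat -> R),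
    delta_packing delta A I x r /\
    t = (\esum_(i in I) diam_pow s (ecball (x i) (r i)))%E].

(* packing_delta is nondecreasing in delta: the limit at 0 is an infimum. *)
Definition packing_premeasure (R : realType) (n : nat) (s : R)
    (A : set 'rV[R]_n) : \bar R :=
  ereal_inf [set packing_delta s delta A
            | delta in [set delta : R | 0 < delta]].

(* packing_premeasure is not countably subadditive, hence this second step. *)
Definition packing_measure (R : realType) (n : nat) (s : R)
    (A : set 'rV[R]_n) : \bar R :=
  ereal_inf [set (\sum_(0 <= i <oo) packing_premeasure s (F i))%E
            | F in [set F : nat -> set 'rV[R]_n | A `<=` \bigcup_i F i]].

Definition packing_dim (R : realType) (n : nat) (A : set 'rV[R]_n) : \bar R :=
  ereal_inf [set s%:E | s in [set s : R | 0 <= s /\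
                                          packing_measure s A = 0%E]].

Inductive dimension := Hausdorff | Box | Packing.

Definition has_dim (R : realType) (n : nat) (D : dimension)
    (A : set 'rV[R]_n) (beta : R) : Prop :=
  match D with
  | Hausdorff => hausdorff_dim A = beta%:E
  | Box => has_box_dim A beta%:E
  | Packing => packing_dim A = beta%:E
  end.

Definition rect (R : realType) (a b c d : R) : set (R * R) :=
  `[a, b] `*` `[c, d].

(* Functions on a set X are represented by total functions whose values
   outside X are irrelevant. *)
Definition continuous_functions (R : realType) (X : set (R * R)) :
    set (R * R -> R) :=
  [set g | {within X, continuous g}].

Definition sup_norm (R : realType) (X : set (R * R)) (h : R * R -> R) : R :=
  sup [set `|h x| | x in X].

Definition graph (R : realType) (X : set (R * R)) (g : R * R -> R) :
    set 'rV[R]_3 :=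
  [set \row_(i < 3) [:: x.1; x.2; g x]`_i | x in X].

Definition graph_dim_class (R : realType) (D : dimension) (X : set (R * R))
    (beta : R) : set (R * R -> R) :=
  [set g | continuous_functions X g /\ has_dim D (graph X g) beta].

(* Main.v *)
(** Subtract a small multiple of a zigzag function [h] of the first variable
    from a Lipschitz minorant [p] of [f] (an infimal convolution).  Put
    [alpha := 3 - beta].  The function [h] maps each triadic interval of length
    [3^-n] onto a triadic interval of length [3^-b(n)], where [b(n) / n] tends
    to [alpha] and [b] is unbounded, even when [alpha = 0]; moreover [h]
    distributes length uniformly over its range.  Hence the graph of
    [p - del h] is covered by [O(r^-beta)] sets of diameter [r], and the part
    of the rectangle over a set of diameter [r] has area [O(r^s)] for each
    [s < beta].  By the mass distribution principle these two estimates
    determine the Hausdorff, box and packing dimensions at once; the lower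
    bound for packings needs no Vitali covering lemma, as balls of one radius
    suffice. *)
Require Import Defs.
From HB Require Import structures.
From mathcomp Require Import all_boot all_order all_algebra.
From mathcomp Require Import all_classical all_reals all_analysis.
From mathcomp Require Import zify ring lra.
Set Implicit Arguments.
Unset Strict Implicit.
Unset Printing Implicit Defensive.
Import Order.TTheory GRing.Theory Num.Theory.
Import numFieldNormedType.Exports.
Local Open Scope classical_set_scope.
Local Open Scope ring_scope.

(* [edist] would otherwise be the extended distance of MathComp-Analysis. *)
Local Notation edist := Defs.edist.

(** * Combinatorics of the labels of triadic cells *)

(* Levels where [b] does not grow fold the graph into three laps (flipping the
   middle one); the other levels split the value into three.  The
   boolean records whether the piece is traversed downwards. *)
Fixpoint zigzag (b : nat -> nat) (n j : nat) : nat * bool :=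
  if n is n'.+1 then
    let: (v, flip) := zigzag b n' (j %/ 3) in
    if b n == b n' then (v, flip (+) (j %% 3 == 1)%N)
    else (3 * v + (if flip then 2 - j %% 3 else j %% 3), flip)%N
  else (j, false).

Definition zigzag_label b n j := (zigzag b n j).1.

(** [b n] counts the splitting levels among the first [n], so a label at level [n] stands for a
    value interval of length [3 ^- b n]. *)
Definition unit_steps (b : nat -> nat) :=
  b 0 = 0%N /\ forall n, b n.+1 = b n \/ b n.+1 = (b n).+1.

Section zigzag_label.
Variable b : nat -> nat.
Hypothesis b_steps : unit_steps b.
Local Notation label := (zigzag_label b).

Lemma unit_steps_le n : (b n <= n)%N.
Proof.
by elim: n => [|n IH]; [rewrite b_steps.1 | case: (b_steps.2 n) => ->; lia].
Qed.

(** Discrete intermediate values; this yields a level at which the value resolution is exactly a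
    prescribed power of 3. *)
Lemma unit_steps_surj : (forall m, exists n, (m <= b n)%N) ->
  forall m, exists n, b n = m.
Proof.
move=> b_unbounded m; case: (b_unbounded m) => n.
elim: n => [|n IH]; first by rewrite b_steps.1 => ?; exists 0%N; rewrite b_steps.1; lia.
case: (b_steps.2 n) => E; first by rewrite E.
rewrite E leq_eqVlt => /predU1P[->|]; first by exists n.+1.
by rewrite ltnS.
Qed.

(** The value interval of a cell contains those of its three children; this nesting is what makes
    the limit function well defined. *)
Lemma zigzag_labelS n j :
  (b n.+1 = b n /\ label n.+1 j = label n (j %/ 3)) \/
  (b n.+1 = (b n).+1 /\
   (3 * label n (j %/ 3) <= label n.+1 j <= 3 * label n (j %/ 3) + 2)%N).
Proof.
rewrite /zigzag_label /=; case: (zigzag b n (j %/ 3)) => v o /=.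
case: (b_steps.2 n) => E; first by left; rewrite E eqxx.
right; split=> //; case: eqP => [|_]; first by lia.
by case: o => /=; have := ltn_pmod j (isT : (0 < 3)%N); lia.
Qed.

(** The directions carry the induction: neighbours with equal labels run in opposite directions, so
    after a split the last child of one and the first child of the other still share a label.
    Continuity of the zigzag rests on this. *)
Lemma zigzag_adjacent n j (p := zigzag b n j) (q := zigzag b n j.+1) :
  [\/ p.1 = q.1 /\ p.2 = ~~ q.2,
      [/\ q.1 = p.1.+1, ~~ p.2 & ~~ q.2] |
      [/\ p.1 = q.1.+1, p.2 & q.2]].
Proof.
rewrite /p /q {p q}; elim: n j => [|n IH] j /=; first by constructor 2.
have [[Ed Em]|[Ed Em]] : (j.+1 %/ 3 = j %/ 3 /\ j.+1 %% 3 = (j %% 3).+1)%N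
    \/ (j.+1 %/ 3 = (j %/ 3).+1 /\ (j %% 3 = 2 /\ j.+1 %% 3 = 0))%N by lia.
  have : (j %% 3 < 2)%N by lia.
  rewrite Ed Em; case: (zigzag b n (j %/ 3)) => v o /=.
  case: eqP => _ /=; case: o; case: (j %% 3)%N => [|[|//]] _ /=;
    (try by constructor 1); (try by constructor 2; split=> //=; lia);
    constructor 3; split=> //=; lia.
have := IH (j %/ 3)%N; rewrite Ed !Em.1 Em.2.
case: (zigzag b n (j %/ 3)) => v o; case: (zigzag b n _.+1) => v' o' /=.
case: eqP => _ /=; rewrite ?addbF.
  by case=> [[-> ->]|[-> ? ?]|[-> ? ?]]; [constructor 1|constructor 2|constructor 3].
case=> [[-> ->]|[-> /negPf-> /negPf->]|[-> -> ->]].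
- by constructor 1; split=> //; case: o' => /=; lia.
- by constructor 2; split=> //=; lia.
- by constructor 3; split=> //=; lia.
Qed.

Lemma zigzag_label_adjacent n j :
  (label n j.+1 <= (label n j).+1)%N /\ (label n j <= (label n j.+1).+1)%N.
Proof.
rewrite /zigzag_label; case: (zigzag_adjacent n j) => [[-> _]|[-> _ _]|[-> _ _]];
  lia.
Qed.

(** Uniform distribution of length, by induction on [k]. At a folding level all three children
    inherit the label of their parent, so the count triples. At a splitting level only a parent
    labelled [v %/ 3] can have a child labelled [v], and at most one, so the count does not grow. *)
Lemma zigzag_label_fiber n k j v :
  ((\sum_(0 <= i < 3 ^ k) (label (k + n) (j * 3 ^ k + i) == v)) * 3 ^ b (k + n)
     <= 3 ^ k * 3 ^ b n)%N.
Proof.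
elim: k v => [|k IH] v.
  by rewrite expn0 mul1n big_nat1 add0n; case: (_ == _); rewrite ?mul1n.
(* The youngest generation is grouped by parent. *)
have split3 i : (\sum_(i * 3 <= l < i.+1 * 3)
      (label (k.+1 + n) (j * 3 ^ k.+1 + l) == v) =
    \sum_(0 <= e < 3) (label (k.+1 + n) (3 * (j * 3 ^ k + i) + e) == v))%N.
  rewrite -{1}[(i * 3)%N]add0n big_addn (_ : (i.+1 * 3 - i * 3 = 3)%N); last lia.
  by apply: eq_bigr => e _; do 3 f_equal; rewrite expnS; lia.
rewrite expnSr big_nat_mul; under eq_bigr do rewrite -expnSr split3.
have div3 i e : (e < 3)%N -> ((3 * i + e) %/ 3 = i)%N by lia.
have mod3 i e : (e < 3)%N -> ((3 * i + e) %% 3 = e)%N by lia.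
case: (b_steps.2 (k + n)%N) => E.
  rewrite addSn E.
  under eq_bigr => i _.
    rewrite (_ : (\sum_(_ <= _ < _) _ =
      (label (k + n) (j * 3 ^ k + i) == v) * 3)%N); last first.
      rewrite big_nat_cond (eq_bigr
        (fun=> (label (k + n) (j * 3 ^ k + i) == v) : nat)).
        by rewrite -big_nat_cond sum_nat_const_nat mulnC.
      move=> e /andP[/andP[_ e3] _].
      case: (zigzag_labelS (k + n) (3 * (j * 3 ^ k + i) + e)) => -[E' H];
        last by lia.
      by rewrite H div3.
    over.
  by rewrite -big_distrl /=; move: (IH v); lia.
rewrite addSn E.
have le1 i : (\sum_(0 <= e < 3) (label (k + n).+1 (3 * (j * 3 ^ k + i) + e) == v)
    <= (label (k + n) (j * 3 ^ k + i) == v %/ 3))%N.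
  rewrite /zigzag_label /= !big_nat_recr //= big_geq // !div3 // !mod3 //.
  case: (zigzag b (k + n) (j * 3 ^ k + i)) => w o /=.
  rewrite E (_ : (_.+1 == _) = false); last by lia.
  by case: o => /=; case: (v %% 3)%N (divn_eq v 3) (ltn_pmod v (isT : (0 < 3)%N))
    => [|[|[|//]]] ev _; lia.
have le_sum : (\sum_(0 <= i < 3 ^ k)
      \sum_(0 <= e < 3) (label (k + n).+1 (3 * (j * 3 ^ k + i) + e) == v)
    <= \sum_(0 <= i < 3 ^ k) (label (k + n) (j * 3 ^ k + i) == v %/ 3))%N.
  by apply: leq_sum => i _; exact: le1.
apply: leq_trans (leq_mul le_sum (leqnn _)) _.
by have := IH (v %/ 3)%N; rewrite !expnS; nia.
Qed.
(** Sum of the fiber bound over [m] consecutive cells of level [n] and over the [q.+1] labels of the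
    window. *)
Lemma zigzag_label_window n k j m lo q :
  ((\sum_(0 <= i < m * 3 ^ k) (lo <= label (k + n) (j * 3 ^ k + i) <= lo + q)) *
     3 ^ b (k + n) <= m * q.+1 * (3 ^ k * 3 ^ b n))%N.
Proof.
have window v : ((lo <= v <= lo + q) <= \sum_(0 <= w < q.+1) (v == lo + w))%N.
  case: andP => [[lov vq]|//]; rewrite (bigD1_seq (v - lo)%N) ?iota_uniq //=.
    by rewrite subnKC // eqxx.
  by rewrite mem_index_iota; lia.
rewrite big_nat_mul big_distrl /= -mulnA -[X in (_ <= X * _)%N](subn0 m).
rewrite -sum_nat_const_nat; apply: leq_sum => e _.
have -> : (\sum_(e * 3 ^ k <= i < e.+1 * 3 ^ k)
    (lo <= label (k + n) (j * 3 ^ k + i) <= lo + q) =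
  \sum_(0 <= i < 3 ^ k) (lo <= label (k + n) ((j + e) * 3 ^ k + i) <= lo + q))%N.
  rewrite -{1}[(e * 3 ^ k)%N]add0n big_addn mulSn addnK.
  by apply: eq_bigr => i _; rewrite mulnDl -addnA [(i + _)%N]addnC.
have le_win : (\sum_(0 <= i < 3 ^ k)
      (lo <= label (k + n) ((j + e) * 3 ^ k + i) <= lo + q) <=
    \sum_(0 <= w < q.+1)
      \sum_(0 <= i < 3 ^ k) (label (k + n) ((j + e) * 3 ^ k + i) == lo + w))%N.
  by rewrite exchange_big /=; apply: leq_sum => i _; exact: window.
apply: leq_trans (leq_mul le_win (leqnn _)) _.
rewrite big_distrl /= -[X in (_ <= X * _)%N](subn0 q.+1) -sum_nat_const_nat.
by apply: leq_sum => w _; exact: zigzag_label_fiber.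
Qed.

End zigzag_label.

(** * The zigzag function on the real line *)

Section zigzag_fun.
Variables (R : realType) (b : nat -> nat).
Hypothesis b_steps : unit_steps b.
Local Notation label := (zigzag_label b).

(* [truncn] vanishes on negative numbers. *)
Definition cell n (x : R) : nat := Num.truncn (3 ^+ n * x).

(** The left ends of the nested value intervals increase with [n], so this supremum is a common
    point of all these intervals. Negative numbers all lie in cell [0] at every level. *)
Definition zigzag_fun (x : R) : R :=
  sup (range (fun n => (label n (cell n x))%:R / 3 ^+ b n)).

Lemma cellS n x : cell n x = (cell n.+1 x %/ 3)%N.
Proof.
rewrite /cell exprS -mulrA; set u := 3 ^+ n * x.
have [u0|u0] := leP 0 u; last first.
  by rewrite !truncn_floor leNgt u0 leNgt pmulr_rlt0 // u0.
apply: truncn_def; have /andP[] := truncn_itv (mulr_ge0 (ler0n R 3) u0).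
set m := Num.truncn _; rewrite [in m%:R](divn_eq m 3) [in m.+1](divn_eq m 3).
have : (m %% 3 <= 2)%N by rewrite -ltnS ltn_pmod.
rewrite -(ler_nat R) -[(_ + _).+1]addn1 -[(m %/ 3).+1]addn1 !natrD !natrM.
have := ler0n R (m %% 3); lra.
Qed.

Lemma cell_add k n x : cell n x = (cell (k + n) x %/ 3 ^ k)%N.
Proof.
elim: k => [|k ->]; first by rewrite divn1.
by rewrite addSn (cellS (k + n)) expnS divnMA.
Qed.

Lemma cell_close n x y : `|x - y| <= (3 ^+ n)^-1 ->
  (cell n y <= (cell n x).+1)%N.
Proof.
move=> xy; rewrite /cell truncn_le_nat.
have : 3 ^+ n * x < (Num.truncn (3 ^+ n * x)).+1%:R := truncnS_gt _.
rewrite -[X in _ -> _ < X]natr1 => xlt.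
have : 3 ^+ n * (y - x) <= 1.
  rewrite mulrC -ler_pdivlMr ?exprn_gt0 // mul1r.
  by apply: le_trans xy; rewrite distrC ler_norm.
by rewrite mulrBr; lra.
Qed.

Lemma cell_itv n x : 0 <= x ->
  x \in `[(cell n x)%:R / 3 ^+ n, (cell n x).+1%:R / 3 ^+ n].
Proof.
move=> x0; have /andP[] := truncn_itv (mulr_ge0 (exprn_ge0 n (ler0n R 3)) x0).
rewrite in_itv /= ler_pdivrMr ?exprn_gt0 // ler_pdivlMr ?exprn_gt0 //.
by rewrite -/(cell n x) mulrC => -> /ltW.
Qed.

Lemma cell_left_close n x : 0 <= x ->
  `|x - (cell n x)%:R / 3 ^+ n| <= (3 ^+ n)^-1.
Proof.
move=> x0; have := cell_itv n x0; rewrite in_itv /=.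
rewrite -[(cell n x).+1%:R]natr1 mulrDl mul1r ler_norml => /andP[h1 h2].
have : 0 <= (3 ^+ n)^-1 :> R by rewrite invr_ge0 exprn_ge0.
by move=> h0; apply/andP; split; lra.
Qed.

Lemma cell_eq_close n x y : 0 <= x -> 0 <= y -> cell n x = cell n y ->
  `|x - y| <= (3 ^+ n)^-1.
Proof.
move=> x0 y0 xy; have := cell_itv n x0; have := cell_itv n y0; rewrite xy !in_itv.
rewrite /= -[(cell n y).+1%:R]natr1 mulrDl mul1r ler_norml.
by move=> /andP[? ?] /andP[? ?]; apply/andP; split; lra.
Qed.

Let low n x : R := (label n (cell n x))%:R / 3 ^+ b n.
Let high n x : R := (label n (cell n x)).+1%:R / 3 ^+ b n.

Let low_high n x : low n x <= low n.+1 x /\ high n.+1 x <= high n x.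
Proof.
rewrite /low /high (cellS n x).
case: (zigzag_labelS b_steps n (cell n.+1 x)) => -[-> H]; first by rewrite H.
have p0 : 0 < 3 ^+ b n :> R by rewrite exprn_gt0.
rewrite exprS invfM !mulrA; split; rewrite ler_pM2r ?invr_gt0 //.
  by rewrite ler_pdivlMr // -natrM ler_nat; lia.
by rewrite ler_pdivrMr // -natrM ler_nat; lia.
Qed.

(** Nested intervals: left ends increase and right ends decrease, so each right end bounds all the
    left ends. *)
Lemma zigzag_fun_itv n x : (label n (cell n x))%:R / 3 ^+ b n <= zigzag_fun x
  <= (label n (cell n x)).+1%:R / 3 ^+ b n.
Proof.
have low_mono m k : low m x <= low (k + m)%N x.
  by elim: k => [//|k /le_trans]; apply; exact: (low_high _ _).1.
have high_mono m k : high (k + m)%N x <= high m x.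
  by elim: k => [//|k]; apply: le_trans; exact: (low_high _ _).2.
have low_le_high m : low m x <= high n x.
  apply: le_trans (low_mono m n) _; rewrite addnC.
  apply: le_trans (high_mono n m); rewrite /low /high.
  by rewrite ler_pM2r ?invr_gt0 ?exprn_gt0 // ler_nat.
have ub : ubound (range (low ^~ x)) (high n x) by move=> _ [m _ <-].
apply/andP; split; last by apply: ge_sup => //; exists (low 0 x), 0%N.
by apply: ub_le_sup; [exists (high n x) | exists n].
Qed.

(** Points this close lie in equal or adjacent cells, whose labels differ by at most one; the two
    values then lie in two touching intervals of length [3 ^- b n]. *)
Lemma zigzag_fun_close n x y : `|x - y| <= (3 ^+ n)^-1 ->
  `|zigzag_fun x - zigzag_fun y| <= 2 / 3 ^+ b n.
Proof.
move=> xy; have yx : `|y - x| <= (3 ^+ n)^-1 by rewrite distrC.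
have {xy yx} : (label n (cell n x) <= (label n (cell n y)).+1)%N /\
    (label n (cell n y) <= (label n (cell n x)).+1)%N.
  have := cell_close xy; have := cell_close yx.
  rewrite leq_eqVlt ltnS => /predU1P[-> _|].
    by have := zigzag_label_adjacent b n (cell n y); lia.
  move=> cxy; rewrite leq_eqVlt ltnS => /predU1P[->|cyx].
    by have := zigzag_label_adjacent b n (cell n x); lia.
  by have /eqP -> : cell n x == cell n y; [rewrite eqn_leq cxy | lia].
have := zigzag_fun_itv n x; have := zigzag_fun_itv n y.
move: (label n _) (label n _) => p q.
have p0 : 0 < (3 ^+ b n)^-1 :> R by rewrite invr_gt0 exprn_gt0.
rewrite -!natr1 -!(ler_nat R) -!natr1 ler_norml.
move: (3 ^+ b n)^-1 p0 => t t0 /andP[h1 h2] /andP[h3 h4] [h5 h6].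
by apply/andP; split; nra.
Qed.

End zigzag_fun.

(** * Integer sequences with a prescribed growth rate *)

(** The sequence is the integer part of [alpha * n + (1 - alpha) * l n], where [l] is a binary
    logarithm. The logarithm makes it unbounded even for [alpha = 0] without changing the rate, and
    the weight [1 - alpha] keeps its increments between 0 and 1. *)
Lemma exists_unit_steps_rate (R : realType) (alpha : R) : 0 <= alpha <= 1 ->
  exists b, [/\ unit_steps b, forall m, exists n, (m <= b n)%N,
    forall n, alpha * n%:R - 1 <= (b n)%:R &
    forall e, 0 < e -> exists K : R, forall n, (b n)%:R <= (alpha + e) * n%:R + K].
Proof.
move=> /andP[a0 a1]; pose l n := trunc_log 2 n.+1.
have lS n : l n.+1 = l n \/ l n.+1 = (l n).+1.
  have h1 : (l n <= l n.+1)%N by apply: leq_trunc_log.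
  have h2 : (2 ^ l n.+1 <= n.+2)%N by apply: trunc_logP.
  have h3 : (n.+1 < 2 ^ (l n).+1)%N by apply: trunc_log_ltn.
  have : (2 ^ l n.+1 < 2 ^ (l n).+2)%N.
    by apply: leq_ltn_trans h2 _; rewrite (expnS 2 (l n).+1); lia.
  by rewrite ltn_exp2l //; lia.
have l_le n : (l n <= n)%N.
  by rewrite -ltnS; apply: leq_trans (ltn_expl (l n) (isT : 1 < 2)%N) _; exact: trunc_logP.
(* Explicit sublinearity of the logarithm: if [l n > M], then [2 ^ l n = 2 ^ (l n - M) * 2 ^ M] is
   at least [(l n - M) * M]. *)
have l_small M n : (M * l n <= n.+1 + M * M)%N.
  have [?|Ml] := leqP (l n) M; first by nia.
  have : (2 ^ l n <= n.+1)%N by apply: trunc_logP.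
  rewrite -{1}(subnK (ltnW Ml)) expnD => h.
  have := ltn_expl (l n - M) (isT : 1 < 2)%N; have := ltn_expl M (isT : 1 < 2)%N.
  move: h Ml; move: (2 ^ (l n - M))%N (2 ^ M)%N => p q ? ? ? ?.
  have : ((l n - M) * M <= p * q)%N by apply: leq_mul; lia.
  by nia.
pose u n : R := alpha * n%:R + (1 - alpha) * (l n)%:R.
have u0 n : 0 <= u n by rewrite addr_ge0 // mulr_ge0 // subr_ge0.
have u_itv n := truncn_itv (u0 n).
exists (Num.truncn \o u) => /=; split.
- split.
    by rewrite /comp /u /l trunc_log1 !mulr0 add0r truncn0.
  move=> n; rewrite /comp; suff [h1 h2] : u n <= u n.+1 /\ u n.+1 <= u n + 1.
    have := le_truncn h1; rewrite leq_eqVlt => /predU1P[<-|h3]; first by left.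
    right; apply/eqP; rewrite eqn_leq h3 truncn_le_nat andbT.
    by have /andP[_] := u_itv n; rewrite -[X in _ -> _ < X]natr1; lra.
  by rewrite /u; case: (lS n) => ->; rewrite -?natr1; lra.
(* [u n] is a convex combination of [n] and [l n], hence at least [l n]. *)
- move=> m; exists (2 ^ m)%N; rewrite truncn_ge_nat //.
  have : (m <= l (2 ^ m))%N by apply: trunc_log_max => //; lia.
  have := l_le (2 ^ m)%N; rewrite -!(ler_nat R) /u.
  by move: (2 ^ m)%:R (l _)%:R => x y; nra.
- move=> n; have /andP[_] := u_itv n; rewrite -natr1 => h.
  have : 0 <= (1 - alpha) * (l n)%:R by rewrite mulr_ge0 // subr_ge0.
  by move: h; rewrite /u; lra.
(* Since [M.+1] exceeds [e^-1], [l_small] bounds [l n] by [e * n] plus a constant. *)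
- move=> e e0; have M_gt : e^-1 < (Num.truncn e^-1).+1%:R := truncnS_gt _.
  move: (Num.truncn _) M_gt => M; rewrite invf_plt ?posrE ?ltr0n // => M_gt.
  exists (1 + M.+1%:R) => n; have /andP[+ _] := u_itv n; move/le_trans; apply.
  have := l_small M.+1 n; rewrite -(ler_nat R) natrD !natrM -[n.+1%:R]natr1.
  have M1 : 1 <= M.+1%:R :> R by rewrite ler1n.
  have : M.+1%:R * M.+1%:R^-1 = 1 :> R by rewrite divff // pnatr_eq0.
  move: M_gt M1; rewrite /u mulrDl; have := ler0n R n; have := ler0n R (l n).
  move: (l n)%:R (n%:R) M.+1%:R (M.+1%:R^-1) => L x m t L0 x0 te m1 mt h.
  have t0 : 0 < t by nra.
  have hL : L <= (x + 1) * t + m.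
    by rewrite -(ler_pM2l (lt_le_trans ltr01 m1)) mulrDr [m * (_ * t)]mulrCA mt; lra.
  have : (1 - alpha) * L <= L by nra.
  have : x * t <= x * e by nra.
  have : t <= 1 by nra.
  by nra.
Qed.

(** * Diameters, weights and Euclidean balls *)

Section diameter.
Variables (R : realType) (n : nat).
Implicit Types (x y : 'rV[R]_n) (A : set 'rV[R]_n) (r s : R).

Lemma coord_le_edist x y i : `|x 0 i - y 0 i| <= edist x y.
Proof.
rewrite /edist -sqrtr_sqr ler_wsqrtr // (bigD1 i) //= lerDl.
by apply: sumr_ge0 => j _; exact: sqr_ge0.
Qed.

(** The factor [n] instead of its square root is crude, but constants do not affect dimensions. *)
Lemma edist_le_coord x y r : (forall i, `|x 0 i - y 0 i| <= r) ->
  edist x y <= n%:R * r.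
Proof.
(* For [n = 0] the hypothesis does not force [r] to be nonnegative. *)
move=> xy; case: (posnP n) xy => [n0|n_gt0] xy.
  rewrite /edist big1 ?sqrtr0 => [|i]; last by have := ltn_ord i; rewrite [X in (_ < X)%N]n0.
  by rewrite n0 mul0r.
have r0 : 0 <= r := le_trans (normr_ge0 _) (xy (Ordinal n_gt0)).
rewrite -[n%:R * r]ger0_norm ?mulr_ge0 // -sqrtr_sqr ler_wsqrtr //.
apply: (@le_trans _ _ (n%:R * r ^+ 2)); last first.
  rewrite exprMn ler_wpM2r ?sqr_ge0 // -natrX ler_nat.
  by rewrite -{1}[n]expn1 leq_pexp2l.
rewrite -[X in X%:R * _]card_ord mulr_natl -sumr_const ler_sum // => i _.
by rewrite -real_normK ?num_real // ler_pXn2r ?nnegrE.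
Qed.

Lemma diam_ge0 A : (0 <= diam A)%E.
Proof. by rewrite /diam le_max lexx. Qed.

Lemma edist_le_diam A x y : A x -> A y -> ((edist x y)%:E <= diam A)%E.
Proof.
move=> Ax Ay; rewrite /diam le_max; apply/orP; right.
by apply: ereal_sup_ubound; exists (x, y).
Qed.

Lemma diam_le A r : 0 <= r -> (forall x y, A x -> A y -> edist x y <= r) ->
  (diam A <= r%:E)%E.
Proof.
move=> r0 Ar; rewrite /diam ge_max lee_fin r0 /=.
by apply: ge_ereal_sup => _ [[x y] [/= Ax Ay] <-]; rewrite lee_fin Ar.
Qed.

Lemma diam_set0 : diam (@set0 'rV[R]_n) = 0%E.
Proof.
by apply/eqP; rewrite eq_le diam_ge0 andbT; apply: diam_le.
Qed.

Lemma diam_pow_ge0 s A : (0 <= diam_pow s A)%E.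
Proof. by rewrite /diam_pow; case: ifP => // _; exact: poweR_ge0. Qed.

Lemma diam_pow_set0 s : diam_pow s (@set0 'rV[R]_n) = 0%E.
Proof. by rewrite /diam_pow asboolT. Qed.

Lemma diam_pow_neq0 s A : A !=set0 -> diam_pow s A = poweR (diam A) s.
Proof. by move=> /set0P/eqP A0; rewrite /diam_pow asboolF. Qed.

Lemma diam_pow_le s A r : 0 <= s -> 0 <= r -> (diam A <= r%:E)%E ->
  (diam_pow s A <= (r `^ s)%:E)%E.
Proof.
move=> s0 r0 Ar; rewrite /diam_pow; case: ifP => _.
  by rewrite lee_fin powR_ge0.
by rewrite -poweR_EFin gt0_ler_poweR // in_itv /= ?diam_ge0 ?leey // lee_fin r0.
Qed.

Lemma diam_pow_ge s A r : 0 <= s -> 0 <= r -> A !=set0 -> (r%:E <= diam A)%E ->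
  ((r `^ s)%:E <= diam_pow s A)%E.
Proof.
move=> s0 r0 A0 rA; rewrite diam_pow_neq0 //.
by rewrite -poweR_EFin gt0_ler_poweR // in_itv /= ?diam_ge0 ?leey // lee_fin r0.
Qed.

Lemma edist_xx x : edist x x = 0.
Proof. by rewrite /edist big1 ?sqrtr0 // => i _; rewrite subrr expr0n. Qed.

Lemma diam_ecball_le x r : 0 <= r -> (diam (ecball x r) <= (n%:R * (2 * r))%:E)%E.
Proof.
move=> r0; apply: diam_le => [|y z xy xz]; first by rewrite !mulr_ge0.
apply: edist_le_coord => i.
have /le_trans/(_ xy) := coord_le_edist x y i.
have /le_trans/(_ xz) := coord_le_edist x z i.
by rewrite !ler_norml; lra.
Qed.

Lemma ecball_meet x y r : ecball x r `&` ecball y r !=set0 ->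
  forall i, `|x 0 i - y 0 i| <= 2 * r.
Proof.
move=> [z [xz yz]] i.
have /le_trans/(_ xz) := coord_le_edist x z i.
have /le_trans/(_ yz) := coord_le_edist y z i.
by rewrite !ler_norml; lra.
Qed.

End diameter.

(** The witness is the point at distance [r] from the centre along the first axis, which is why the
    dimension is positive. *)
Lemma diam_ecball_ge (R : realType) n (x : 'rV[R]_n.+1) r : 0 <= r ->
  (r%:E <= diam (ecball x r))%E.
Proof.
move=> r0; pose y : 'rV[R]_n.+1 := x + r *: delta_mx 0 0.
have xyE : edist x y = r.
  rewrite /edist (bigD1 0) //= big1 => [|i /negPf i0]; last first.
    by rewrite !mxE i0 andbF mulr0 addr0 subrr expr0n.
  by rewrite !mxE !eqxx mulr1 addr0 opprD addrA subrr sub0r sqrrN sqrtr_sqr ger0_norm.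
rewrite -{1}xyE; apply: edist_le_diam => /=.
  by rewrite /ecball /= edist_xx.
by rewrite /ecball /= xyE.
Qed.

(** * Critical exponents, finite families, geometric scales and counting of packings *)

Lemma exists_small_power (R : realType) (p e d : R) : 0 < p -> 0 < e -> 0 < d ->
  exists r, [/\ 0 < r, r < d, r < 1 & r `^ p <= e].
Proof.
move=> p0 e0 d0; pose m : R := Num.min (Num.min d 1) (e `^ p^-1).
have m0 : 0 < m by rewrite !lt_min d0 ltr01 powR_gt0.
exists (m / 2); split; first by rewrite divr_gt0.
- by apply: (@lt_le_trans _ _ m); [lra | rewrite !ge_min lexx].
- by apply: (@lt_le_trans _ _ m); [lra | rewrite !ge_min lexx orbT].
- apply: (@le_trans _ _ ((e `^ p^-1) `^ p)).
    apply: ge0_ler_powR; rewrite ?nnegrE ?powR_ge0 ?(ltW p0) //; first lra.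
    by apply: (@le_trans _ _ m); [lra | rewrite !ge_min lexx !orbT].
  by rewrite -powRrM mulVf ?gt_eqF // powRr1 // ltW.
Qed.

(** Common form of the Hausdorff and packing dimensions, [P s] being the vanishing of the
    [s]-dimensional measure; the critical exponent itself is left open. *)
Lemma ereal_inf_threshold (R : realType) (P : R -> Prop) (beta : R) : 0 <= beta ->
  (forall s, beta < s -> P s) -> (forall s, 0 <= s < beta -> ~ P s) ->
  ereal_inf [set s%:E | s in [set s | 0 <= s /\ P s]] = beta%:E.
Proof.
move=> b0 Pgt Plt; apply/eqP; rewrite eq_le; apply/andP; split.
  apply/lee_addgt0Pr => e e0; apply: ereal_inf_lbound.
  by exists (beta + e) => //; split; [lra | apply: Pgt; lra].
apply: le_ereal_inf_tmp => _ [s [s0 Ps] <-]; rewrite lee_fin leNgt.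
by apply/negP => sb; apply: (Plt s) => //; rewrite s0.
Qed.

Section fin_seq.
Variables (T : Type) (k : nat) (U : 'I_k -> set T).

(** Padding by empty sets, of weight zero, turns a finite cover into a sequence as in
    [delta_cover]. *)
Definition fin_seq (i : nat) : set T := if insub i is Some j then U j else set0.

Lemma fin_seqE (j : 'I_k) : fin_seq j = U j.
Proof. by rewrite /fin_seq valK. Qed.

Lemma fin_seq_oob i : (k <= i)%N -> fin_seq i = set0.
Proof. by move=> ki; rewrite /fin_seq insubF // ltnNge ki. Qed.

Lemma sub_bigcup_fin_seq (A : set T) :
  A `<=` \bigcup_i U i -> A `<=` \bigcup_i fin_seq i.
Proof. by move=> AU x /AU[j _ Ux]; exists j; rewrite ?fin_seqE. Qed.

Lemma nneseries_fin_seq (R : realType) (F : set T -> \bar R) :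
  F set0 = 0%E -> (forall A, (0 <= F A)%E) ->
  (\sum_(0 <= i <oo) F (fin_seq i) = \sum_(i < k) F (U i))%E.
Proof.
move=> F0 Fge0; rewrite (nneseries_split _ k) // [X in (_ + X)%E]eseries0 ?adde0.
  by rewrite add0n big_mkord; under eq_bigr do rewrite fin_seqE.
by move=> i ki _; rewrite fin_seq_oob.
Qed.

End fin_seq.

Lemma esum_le_inj (R : realType) (T : choiceType) (J : set T) (a : T -> \bar R)
    (N : nat) (phi : T -> nat) (w : R) : 0 <= w ->
    (forall i, J i -> (a i <= w%:E)%E) -> set_inj J phi ->
    (forall i, J i -> (phi i < N)%N) ->
  (\esum_(i in J) a i <= (N%:R * w)%:E)%E.
Proof.
move=> w0 aw inj ltN; apply: ge_ereal_sup => _ [F [finF FJ] <-].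
apply: (@le_trans _ _ (\sum_(i \in F) w%:E)%E).
  by apply: lee_fsum => // i /FJ /aw.
rewrite -(fsbig_image F phi (fun=> w%:E)); last first.
  by move=> i j /set_mem/FJ Ji /set_mem/FJ Jj; apply: inj; exact: mem_set.
apply: (@le_trans _ _ (\sum_(i \in `I_N) w%:E)%E).
  apply: lee_fsum_nneg_subset => //; first exact: finite_image.
  by move=> _ /set_mem[i /FJ Ji <-]; apply/mem_set; exact: ltN.
by rewrite -(fsbig_ord _ _ (fun=> w%:E)) sumEFin sumr_const card_ord mulr_natl.
Qed.

Lemma nneseries_geometric_le (R : realType) (u : nat -> \bar R) (D q : R) :
    0 <= D -> 0 <= q < 1 -> (forall k, (0 <= u k <= (D * q ^+ k)%:E)%E) ->
  (\sum_(0 <= k <oo) u k <= (D / (1 - q))%:E)%E.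
Proof.
move=> D0 /andP[q0 q1] uD; apply: lime_le.
  by apply: is_cvg_nneseries => k _ _; have /andP[] := uD k.
apply: nearW => m; apply: (@le_trans _ _ (\sum_(0 <= k < m) (D * q ^+ k)%:E)%E).
  by apply: lee_sum => k _; have /andP[] := uD k.
rewrite sumEFin lee_fin -mulr_sumr ler_wpM2l //.
rewrite -[leRHS]mul1r ler_pdivlMr ?subr_gt0 //.
suff -> : (\sum_(0 <= k < m) q ^+ k) * (1 - q) = 1 - q ^+ m.
  by rewrite lerBlDr lerDl exprn_ge0.
elim: m => [|m IH]; first by rewrite big_geq // mul0r expr0 subrr.
by rewrite big_nat_recr //= mulrDl IH exprSr; ring.
Qed.

Lemma powRXn (R : realType) (x p : R) m : 0 <= x -> (x ^+ m) `^ p = (x `^ p) ^+ m.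
Proof.
move=> x0; rewrite -(powR_mulrn m x0) -(powR_mulrn m (powR_ge0 x p)).
exact: powRAC.
Qed.

Lemma exists_expr_lt (R : realType) (q t : R) : 0 <= q < 1 -> 0 < t ->
  exists m, q ^+ m < t.
Proof.
move=> /andP[q0 q1] t0; have : `|q| < 1 by rewrite ger0_norm.
move/cvg_expr/cvgrPdist_lt => /(_ t t0) [m _ /(_ m (leqnn m))] /=.
by rewrite sub0r normrN normrX ger0_norm //; exists m.
Qed.

Lemma geometric_scale (R : realType) (q r : R) k0 : 0 < q < 1 ->
  0 < r <= q ^+ k0 -> exists k, q ^+ (k0 + k).+1 < r <= q ^+ (k0 + k).
Proof.
move=> /andP[q0 q1] /andP[r0 rk0].
have [|m qm] := @exists_expr_lt R q r _ r0; first by rewrite (ltW q0).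
pose P k := q ^+ (k0 + k).+1 < r.
have exP : exists k, P k.
  by exists m; apply: le_lt_trans qm; apply: ler_wiXn2l; rewrite ?ltW //; lia.
exists (ex_minn exP); case: ex_minnP => k Pk kmin; apply/andP; split=> //.
case: k Pk kmin => [|k] _ kmin; first by rewrite addn0.
by rewrite leNgt addnS; apply/negP => /kmin; rewrite ltnn.
Qed.

(* A set of diameter at most [rho] contains at most one centre of a packing by
   balls of radii greater than [rho]. *)
Lemma packing_esum_le (R : realType) n (G : set 'rV[R]_n) d I
    (x : nat -> 'rV[R]_n) r rho w k (U : 'I_k -> set 'rV[R]_n) (J : set nat) (a : nat -> \bar R) :
    delta_packing d G I x r -> J `<=` I -> (forall i, J i -> rho < r i) ->
    (forall i, (diam (U i) <= rho%:E)%E) -> G `<=` \bigcup_i U i ->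
    0 <= w -> (forall i, J i -> (a i <= w%:E)%E) ->
  (\esum_(i in J) a i <= (k%:R * w)%:E)%E.
Proof.
move=> [GI disj] JI Jr dU GU w0 aw.
(* The index type is ['I_k.+1] because [k] may be [0] while indices outside [J] still need a default
   value. *)
have /choice[phi phiP] : forall i, exists j : 'I_k.+1,
    J i -> (j < k)%N /\ forall l : 'I_k, l = j :> nat -> U l (x i).
  move=> i; have [Ji|nJ] := pselect (J i); last by exists ord0.
  have [Gx _] := GI i (JI i Ji); have [j _ Uj] := GU _ Gx.
  exists (widen_ord (leqnSn k) j) => _; split=> [|l lj]; first exact: (ltn_ord j).
  by have -> : l = j by exact: val_inj.
apply: (@esum_le_inj _ _ _ _ _ (fun i => phi i : nat)) => // [i j|i /phiP[]//].
move=> /set_mem Ji /set_mem Jj ij; apply: disj; [exact: JI|exact: JI|].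
exists (x i); split.
  rewrite /ecball /= edist_xx; apply: le_trans (ltW (Jr i Ji)).
  exact: le_trans (diam_ge0 _) (dU (Ordinal (phiP i Ji).1)).
have [ik Ui] := phiP i Ji; have [jk Uj] := phiP j Jj.
rewrite /ecball /=; apply: le_trans (ltW (Jr j Jj)).
rewrite -lee_fin; apply: le_trans (dU (Ordinal jk)).
by apply: edist_le_diam; [exact: Uj | apply: Ui].
Qed.

(** * The mass distribution principle for the three dimensions *)

Section dimension.
Variables (R : realType) (n : nat) (G : set 'rV[R]_n.+1) (beta : R).
Variable mu : {outer_measure set 'rV[R]_n.+1 -> \bar R}.

(** Frostman's growth condition for the mass [mu], at every exponent below [beta]; the constant may
    depend on the exponent. *)
Definition frostman_below := forall s, 0 <= s < beta -> exists2 c : R, 0 < c &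
  forall U, (diam U <= 1%:E)%E -> (c%:E * mu (U `&` G) <= diam_pow s U)%E.

Definition box_count_le := exists2 C : R, 0 < C &
  forall r, 0 < r < 1 -> exists k : nat, k%:R <= C * r `^ (- beta) /\
    exists U : 'I_k -> set 'rV[R]_n.+1,
      (forall i, (diam (U i) <= r%:E)%E) /\ G `<=` \bigcup_i U i.

Hypothesis beta_gt0 : 0 < beta.
Hypothesis muG_gt0 : exists2 a : R, 0 < a & (a%:E <= mu G)%E.
Hypothesis lower : frostman_below.
Hypothesis upper : box_count_le.

Let mu_cover_le H (U : nat -> set 'rV[R]_n.+1) c :
  0 < c -> H `<=` G -> H `<=` \bigcup_i U i ->
  (c%:E * mu H <= \sum_(0 <= i <oo) c%:E * mu (U i `&` G))%E.
Proof.
move=> c0 HG HU; rewrite nneseriesZl ?(ltW c0) //.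
rewrite lee_pmul2l ?lte_fin //.
apply: le_trans (outer_measure_sigma_subadditive mu _).
apply: le_outer_measure => x Hx; have [i _ Ux] := HU x Hx; exists i => //.
by split=> //; exact: HG.
Qed.

(** Mass distribution in counting form: covering a set of given mass by sets of diameter at most [r]
    takes at least a constant times [r ^ -s] of them. *)
Let mu_cover_card H k (U : 'I_k -> set 'rV[R]_n.+1) c s r :
    0 < c -> 0 <= s -> 0 <= r <= 1 -> H `<=` G -> H `<=` \bigcup_i U i ->
    (forall U, (diam U <= 1%:E)%E -> (c%:E * mu (U `&` G) <= diam_pow s U)%E) ->
    (forall i, (diam (U i) <= r%:E)%E) ->
  (c%:E * mu H <= (k%:R * r `^ s)%:E)%E.
Proof.
move=> c0 s0 /andP[r0 r1] HG HU cU dU.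
apply: le_trans (mu_cover_le c0 HG (sub_bigcup_fin_seq HU)) _.
rewrite (nneseries_fin_seq _ (F := fun A => (c%:E * mu (A `&` G))%E)).
- rewrite mulr_natl -[X in _ *+ X](card_ord k) -sumr_const -sumEFin.
  apply: lee_sum => i _; apply: le_trans (cU _ _) _.
    by apply: le_trans (dU i) _; rewrite lee_fin.
  exact: diam_pow_le.
- by rewrite set0I outer_measure0 mule0.
- by move=> A; rewrite mule_ge0 ?lee_fin ?(ltW c0) ?outer_measure_ge0.
Qed.

Lemma hausdorff_dimE : hausdorff_dim G = beta%:E.
Proof.
apply: ereal_inf_threshold => [|s sb|s sb]; first exact: ltW.
  have s0 : 0 <= s := ltW (lt_trans beta_gt0 sb).
  have [C C0 GC] := upper.
  apply/eqP; rewrite eq_le; apply/andP; split; last first.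
    apply: le_ereal_sup_tmp; exists (hausdorff_premeasure s 1 G); 
      first by exists (1 : R) => //=; rewrite ltr01.
    apply: le_ereal_inf_tmp => _ [U _ <-].
    by apply: nneseries_ge0 => i _ _; exact: diam_pow_ge0.
  apply: ge_ereal_sup => _ [d d0 <-]; apply/lee_addgt0Pr => e e0; rewrite add0e.
  (* The [k] sets of the cover at scale [r] have total weight at most [k * r ^ s], hence at most
     [C * r ^ (s - beta)]; [r] is chosen to make this at most [e]. *)
  have [r [r0 rd r1 re]] : exists r,
      [/\ 0 < r, r < d, r < 1 & r `^ (s - beta) <= e / C].
    by apply: exists_small_power; rewrite ?subr_gt0 // divr_gt0.
  have [|k [kC [U [dU GU]]]] := GC r; first by rewrite r0.
  apply: ge_ereal_inf; exists (\sum_(0 <= i <oo) diam_pow s (fin_seq U i))%E.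
    exists (fin_seq U) => //; split=> [i|]; last exact: sub_bigcup_fin_seq.
    rewrite /fin_seq; case: insubP => [j _ _|_]; last by rewrite diam_set0 lee_fin ltW.
    by apply: le_trans (dU j) _; rewrite lee_fin ltW.
  rewrite nneseries_fin_seq ?diam_pow_set0 //; last exact: diam_pow_ge0.
  apply: (@le_trans _ _ (\sum_(i < k) (r `^ s)%:E)%E).
    by apply: lee_sum => i _; apply: diam_pow_le => //; exact: ltW.
  rewrite sumEFin lee_fin sumr_const card_ord -mulr_natl.
  apply: le_trans (ler_wpM2r (powR_ge0 _ _) kC) _.
  rewrite -mulrA -powRD ?(gt_eqF r0) ?implybT // addrC mulrC.
  by rewrite -ler_pdivlMr.
have [c c0 cU] := lower sb; have [a a0 aG] := muG_gt0 => Gs0.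
(* Every cover has weight at least [c * mu G]. The single value [delta = 1] suffices, since the
   measure is a supremum over [delta]. *)
have : (c%:E * mu G <= 0)%E.
  rewrite -Gs0; apply: le_ereal_sup_tmp.
  exists (hausdorff_premeasure s 1 G); 
      first by exists (1 : R) => //=; rewrite ltr01.
  apply: le_ereal_inf_tmp => _ [U [dU GU] <-].
  apply: le_trans (mu_cover_le c0 (@subset_refl _ G) GU) _.
  apply: lee_nneseries => i _; last by rewrite cU.
  by rewrite mule_ge0 ?lee_fin ?(ltW c0) ?outer_measure_ge0.
apply/negP; rewrite -ltNge; apply: mule_gt0 => //.
by apply: lt_le_trans aG; rewrite lte_fin.
Qed.

Let covering_number_le : exists2 C : R, 0 < C & forall r, 0 < r < 1 ->
  (covering_number r G <= (C * r `^ (- beta))%:E)%E.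
Proof.
have [C C0 GC] := upper; exists C => // r /GC[k [kC [U [dU GU]]]].
apply: ge_ereal_inf; exists (k%:R)%:E; last by rewrite lee_fin.
by exists k => //; exists U.
Qed.

Let covering_number_ge s : 0 <= s < beta -> exists2 c : R, 0 < c &
  forall r, 0 < r < 1 -> ((c * r `^ (- s))%:E <= covering_number r G)%E.
Proof.
move=> sb; have [c c0 cU] := lower sb; have [a a0 aG] := muG_gt0.
exists (c * a) => [|r /andP[r0 r1]]; first exact: mulr_gt0.
apply: le_ereal_inf_tmp => _ [k [U [dU GU]] <-].
have /andP[s0 _] := sb; have r01 : 0 <= r <= 1 by rewrite !ltW.
apply: (@le_trans _ _ ((r `^ (- s))%:E * (c%:E * mu G))%E).
  rewrite EFinM muleC lee_pmul2l ?lte_fin ?powR_gt0 // EFinM.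
  by rewrite lee_pmul2l ?lte_fin.
have := mu_cover_card c0 s0 r01 (@subset_refl _ G) GU cU dU.
have rs0 : 0 < r `^ (- s) by apply: powR_gt0.
move/(lee_wpmul2l (ltW (_ : 0 < (r `^ (- s))%:E)%E)) => /(_ rs0) /le_trans; apply.
by rewrite -EFinM lee_fin mulrCA -powRD ?(gt_eqF r0) ?implybT // addNr powRr0 mulr1.
Qed.

Lemma has_box_dimE : has_box_dim G beta%:E.
Proof.
have [C C0 leC] := covering_number_le.
have near_bound e : 0 < e -> \forall r \near (0 : R)^'+,
    exists2 q, (lne (covering_number r G) * ((- ln r)^-1)%:E)%E = q%:E &
               `|beta - q| <= e.
  (* An exponent within [e / 2] of [beta]; the maximum keeps it nonnegative. *)
  move=> e0; pose s := Num.max 0 (beta - e / 2).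
  have sb : 0 <= s < beta by rewrite /s le_max lexx gt_max beta_gt0 /=; lra.
  have sge : beta - e / 2 <= s by rewrite /s le_max lexx orbT.
  have [c c0 lec] := covering_number_ge sb.
  (* Once [- ln r >= M], dividing by [- ln r] makes the contributions of [ln C] and [ln c] at most
     [e / 2]; the summand 1 makes [M] positive. *)
  pose M := 2 * (1 + `|ln C| + `|ln c|) / e.
  near=> r.
  have r0 : 0 < r by near: r; exact: nbhs_right_gt.
  have r1 : r < 1 by near: r; exact: nbhs_right_lt.
  have rM : M <= - ln r.
    rewrite lerNr -(expRK (- M)) ler_ln ?posrE ?expR_gt0 //.
    by near: r; apply: nbhs_right_le; exact: expR_gt0.
  have r01 : 0 < r < 1 by rewrite r0.
  have := lec r r01; have := leC r r01.
  case: (covering_number r G) => [x|//|//]; rewrite !lee_fin => xC cx.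
  have crs : 0 < c * r `^ (- s) by rewrite mulr_gt0 ?powR_gt0.
  have x0 : 0 < x by apply: lt_le_trans cx.
  exists (ln x / - ln r); first by rewrite lne_EFin // -EFinM.
  have lnxC : ln x <= ln C + - beta * ln r.
    by rewrite -ln_powR -lnM ?posrE ?powR_gt0 // ler_ln ?posrE ?mulr_gt0 ?powR_gt0.
  have lncx : ln c + - s * ln r <= ln x.
    by rewrite -ln_powR -lnM ?posrE ?powR_gt0 // ler_ln ?posrE ?mulr_gt0 ?powR_gt0.
  have Me : M * e = 2 * (1 + `|ln C| + `|ln c|) by rewrite /M mulfVK ?gt_eqF.
  have := ler_norm (ln C); have := lerNnormlW (lexx `|ln c|).
  have nC := normr_ge0 (ln C); have nc := normr_ge0 (ln c).
  have LE : ln r = - - ln r by rewrite opprK.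
  move: rM Me lnxC lncx; rewrite LE opprK; move: (- ln r) => L rM Me lnxC lncx hc hC.
  have M0 : 0 < M by rewrite divr_gt0 //; lra.
  have L0 : 0 < L by lra.
  have Le : 2 * (1 + `|ln C| + `|ln c|) <= L * e by rewrite -Me ler_pM2r.
  rewrite ler_distlC ler_pdivrMr // ler_pdivlMr //; apply/andP; split; nra.
have near_fin : \forall r \near (0 : R)^'+,
    (lne (covering_number r G) * ((- ln r)^-1)%:E)%E \is a fin_num.
  by apply: filterS (near_bound 1 ltr01) => r [q -> _].
apply/fine_cvgP; split => //; apply/cvgrPdist_le => e e0.
by apply: filterS (near_bound e e0) => r [q /= -> qe].
Unshelve. all: by end_near. Qed.

(** The balls of a packing are sorted dyadically by radius. By [packing_esum_le], the class of radii
    in [(rho, 2 * rho]] has at most [C * rho ^ -beta] balls, so it contributes at most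
    [B * rho ^ (s - beta)]. The classes thus sum to a geometric series of ratio [q]. *)
Lemma packing_measure_gt s : beta < s -> packing_measure s G = 0%E.
Proof.
move=> bs; have s0 : 0 < s := lt_trans beta_gt0 bs.
have pre_ge0 (F : set 'rV[R]_n.+1) : (0 <= packing_premeasure s F)%E.
  apply: le_ereal_inf_tmp => _ [d _ <-]; apply: le_ereal_sup_tmp.
  exists 0%E => //; exists set0, (fun=> 0), (fun=> 0); split; last by rewrite esum_set0.
  by split=> [i []|i j []].
suff pre0 : packing_premeasure s G = 0%E.
  apply/eqP; rewrite eq_le; apply/andP; split.
    apply: ge_ereal_inf; exists 0%E => //; exists (fun=> G).
      by move=> y Gy; exists 0%N.
    by rewrite eseries0.
  by apply: le_ereal_inf_tmp => _ [F _ <-]; apply: nneseries_ge0.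
apply/eqP; rewrite eq_le pre_ge0 andbT; apply/lee_addgt0Pr => e e0; rewrite add0e.
have [C C0 GC] := upper.
pose m : R := n.+1%:R; have m0 : 0 < m by rewrite ltr0n.
pose q : R := 2^-1 `^ (s - beta).
have q0 : 0 < q by apply: powR_gt0; rewrite invr_gt0.
have q1 : q < 1.
  have <- : 1 `^ (s - beta) = 1 :> R by rewrite powR1.
  rewrite gt0_ltr_powR ?subr_gt0 ?nnegrE //; lra.
(* A ball of radius at most [2 * rho] has diameter at most [4 * m * rho] by [diam_ecball_le]. *)
pose B := C * (4 * m) `^ s.
have B0 : 0 < B by rewrite mulr_gt0 // powR_gt0 // mulr_gt0.
(* Starting at scale [2 ^- k0], the whole series [B * q ^+ k0 / (1 - q)] stays below [e]. *)
have [||k0 qk0] := @exists_expr_lt _ q (e * (1 - q) / B) _ _.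
- by rewrite (ltW q0).
- by apply: divr_gt0 => //; apply: mulr_gt0 => //; rewrite subr_gt0.
have half01 : 0 < (2^-1 : R) < 1.
  by rewrite invr_gt0 ltr0n invf_lt1 ?ltr0n // ltr1n.
have half0 k : 0 < 2^-1 ^+ k :> R by rewrite exprn_gt0 // invr_gt0.
apply: ge_ereal_inf; exists (packing_delta s (2^-1 ^+ k0) G) => /=.
  by exists (2^-1 ^+ k0).
apply: ge_ereal_sup => _ [I [x [r [pack ->]]]].
pose J k := [set i | I i /\ 2^-1 ^+ (k0 + k).+1 < r i <= 2^-1 ^+ (k0 + k)].
have -> : I = \bigcup_k J k.
  apply/seteqP; split=> [i Ii|i [k _ []//]].
  by have [_ r01] := pack.1 i Ii; have [k rk] := geometric_scale half01 r01; exists k.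
rewrite nneseries_sum_bigcup; last 2 first.
- apply: ltn_trivIset => k l lk; rewrite -subset0 => i [[_ /andP[h2 _]] [_ /andP[_ h1]]].
  have : 2^-1 ^+ (k0 + k) <= 2^-1 ^+ (k0 + l).+1 :> R.
    have [/ltW h3 /ltW h4] := andP half01; apply: ler_wiXn2l => //.
    by rewrite -addnS leq_add2l.
  by move=> h3; have := lt_le_trans h2 (le_trans h1 h3); rewrite ltxx.
- by move=> i; exact: diam_pow_ge0.
apply: (@le_trans _ _ ((B * q ^+ k0) / (1 - q))%:E); last first.
  by rewrite lee_fin ler_pdivrMr ?subr_gt0 // mulrC -ler_pdivlMr // ltW.
apply: nneseries_geometric_le => [||k].
- by rewrite mulr_ge0 ?exprn_ge0 ?(ltW B0) ?(ltW q0).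
- by rewrite (ltW q0).
have [|N [NC [U [dU GU]]]] := GC (2^-1 ^+ (k0 + k).+1).
  by rewrite half0 exprn_ilt1 ?invr_ge0 ?invf_lt1 ?ltr0n ?ltr1n.
apply/andP; split; first by apply: esum_ge0 => i _; exact: diam_pow_ge0.
pose w : R := (m * (2 * 2^-1 ^+ (k0 + k))) `^ s.
have w0 : 0 <= w by apply: powR_ge0.
apply: (@le_trans _ _ (N%:R * w)%:E).
  apply: (packing_esum_le pack _ _ dU GU) => [i []//|i [_ /andP[]//]|//|i Ji].
  have [_ /andP[ri0 _]] := pack.1 i Ji.1; have [_ /andP[_ rk]] := Ji.
  apply: diam_pow_le; [exact: ltW|by rewrite !mulr_ge0 ?ler0n ?ltW|].
  apply: le_trans (diam_ecball_le _ (ltW ri0)) _.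
  by rewrite lee_fin ler_pM2l // ler_pM2l.
rewrite lee_fin; apply: le_trans (ler_wpM2r w0 NC) _.
pose rho : R := 2^-1 ^+ (k0 + k).+1.
have -> : w = (4 * m) `^ s * rho `^ s.
  rewrite -powRM ?mulr_ge0 ?ler0n ?(ltW (half0 _)) // /w; congr (_ `^ _).
  by rewrite /rho exprS; field.
have -> : C * rho `^ (- beta) * ((4 * m) `^ s * rho `^ s) = B * rho `^ (s - beta).
  rewrite /B powRD ?(gt_eqF (half0 _)) ?implybT //; ring.
rewrite /rho powRXn ?invr_ge0 // -/q -mulrA -exprD ler_pM2l //.
by apply: ler_wiXn2l; rewrite ?ltW.
Qed.

(** Below [beta], the packing premeasure of every set [F] dominates a fixed multiple of the mass of
    [F] in [G]. Summing over a countable cover of [G] keeps the packing measure positive. *)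
Lemma packing_dimE : packing_dim G = beta%:E.
Proof.
apply: ereal_inf_threshold => [|s|s sb]; [exact: ltW|exact: packing_measure_gt|].
have [s0 _] := andP sb; have [c c0 cU] := lower sb; have [a a0 aG] := muG_gt0.
pose m : R := n.+1%:R; have m0 : 0 < m by rewrite ltr0n.
(* The factor pays for passing from balls of radius [r] to covering sets of diameter [4 * m * r]. *)
pose c' := ((4 * m) `^ s)^-1 * c.
have c'0 : 0 < c' by rewrite mulr_gt0 // invr_gt0 powR_gt0 // mulr_gt0.
have lowerF (F : set 'rV[R]_n.+1) : (c'%:E * mu (F `&` G) <= packing_premeasure s F)%E.
  apply: le_ereal_inf_tmp => _ [d /= d0 <-].
  (* The second bound keeps the covering sets at diameter at most 1, where the mass estimate
     applies. *)
  pose r := Num.min d (4 * m)^-1.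
  have r0 : 0 < r by rewrite lt_min d0 invr_gt0 mulr_gt0.
  have rd : r <= d by rewrite ge_min lexx.
  have rm : 4 * m * r <= 1.
    by rewrite -ler_pdivlMl ?mulr_gt0 // mulr1 ge_min lexx orbT.
  pose P k := exists x : nat -> 'rV[R]_n.+1,
    (forall i, (i < k)%N -> (F `&` G) (x i)) /\ trivIset `I_k (fun i => ecball (x i) r).
  have P_le k : P k -> ((k%:R * r `^ s)%:E <= packing_delta s d F)%E.
    move=> [x [Fx disj]]; apply: le_ereal_sup_tmp.
    exists (\esum_(i in `I_k) diam_pow s (ecball (x i) r))%E.
      exists `I_k, x, (fun=> r); split=> //; split=> // i ik.
      by rewrite r0 rd; split=> //; have [] := Fx i ik.
    rewrite esum_fset //; last by move=> i _; exact: diam_pow_ge0.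
    rewrite -(fsbig_ord _ _ (fun i => diam_pow s (ecball (x i) r))).
    rewrite mulr_natl -[X in _ *+ X](card_ord k) -sumr_const -sumEFin.
    apply: lee_sum => i _; apply: diam_pow_ge => //; [exact: ltW| |].
      by exists (x i); rewrite /ecball /= edist_xx ltW.
    by apply: diam_ecball_ge; exact: ltW.
  (* The balls of a maximal packing by balls of radius [r], once doubled, cover
     [F `&` G]. *)
  have [Pall|] := pselect (forall k, P k).
    suff -> : packing_delta s d F = +oo%E by rewrite leey.
    apply/eqyP => M M0; have /P_le := Pall (Num.truncn (M / r `^ s)).+1.
    apply: le_trans; rewrite lee_fin -ler_pdivrMr ?powR_gt0 //.
    by apply/ltW; exact: truncnS_gt.
  move=> /existsNP[k0 nPk0].
  have [k [Pk nPk]] : exists k, P k /\ ~ P k.+1.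
    elim: k0 nPk0 => [[]|k0 IH nP]; first by exists (fun=> 0); split=> // i j [].
    by have [Pk|/IH//] := pselect (P k0); exists k0.
  have /P_le := Pk; apply: le_trans; have [x [Fx disj]] := Pk.
  (* Cubes of half side [2 * r] stand for the doubled balls, matching the coordinate bound of
     [ecball_meet]. *)
  pose U (i : 'I_k) := [set z : 'rV[R]_n.+1 | forall j, `|x i 0 j - z 0 j| <= 2 * r].
  have dU i : (diam (U i) <= (4 * m * r)%:E)%E.
    apply: diam_le => [|y z Uy Uz]; first by rewrite !mulr_ge0 ?ltW.
    apply: le_trans (_ : m * (4 * r) <= _); last by rewrite -mulrA mulrCA.
    by apply: edist_le_coord => j; have := Uy j; have := Uz j; rewrite !ler_norml; lra.
  have FU : F `&` G `<=` \bigcup_i U i.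
    move=> z Fz; apply: contra_notP nPk => nUz.
    exists (fun i => if (i < k)%N then x i else z); split=> [i ik|].
      by case: ifP => [/Fx|].
    have nmeet i : (i < k)%N -> ~ (ecball (x i) r `&` ecball z r !=set0).
      by move=> ik meet; apply: nUz; exists (Ordinal ik) => //; exact: ecball_meet meet.
    move=> i j /=; rewrite 2!ltnS (leq_eqVlt i k) (leq_eqVlt j k).
    move=> /predU1P[->|ik] /predU1P[->|jk]; rewrite ?ltnn ?ik ?jk //.
    + by rewrite setIC => /(nmeet _ jk).
    + by move=> /(nmeet _ ik).
    + by apply: disj.
  have r1 : 0 <= 4 * m * r <= 1 by rewrite rm !mulr_ge0 ?ltW.
  have := mu_cover_card c0 s0 r1 (@subIsetr _ _ _) FU cU dU.
  have -> : (4 * m * r) `^ s = (4 * m) `^ s * r `^ s.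
    by rewrite powRM ?ltW // mulr_gt0.
  rewrite mulrCA EFinM => h.
  by rewrite /c' EFinM -muleA lee_pdivrMl // powR_gt0 // mulr_gt0.
apply/eqP; rewrite gt_eqF //.
apply: (@lt_le_trans _ _ (c' * a)%:E); first by rewrite lte_fin mulr_gt0.
apply: le_ereal_inf_tmp => _ [F GF <-].
apply: (@le_trans _ _ (c'%:E * mu G)%E).
  by rewrite EFinM lee_pmul2l ?lte_fin.
apply: le_trans (mu_cover_le c'0 (@subset_refl _ G) GF) _.
apply: lee_nneseries => i _; last exact: lowerF.
by rewrite mule_ge0 ?lee_fin ?(ltW c'0) ?outer_measure_ge0.
Qed.

Theorem has_dim_of_frostman D : has_dim D G beta.
Proof.
by case: D; [exact: hausdorff_dimE | exact: has_box_dimE | exact: packing_dimE].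
Qed.

End dimension.

(** * Lipschitz minorants of continuous functions *)

Definition dist1 (R : realType) (x y : R * R) : R := `|x.1 - y.1| + `|x.2 - y.2|.

(** Uniform continuity on a compact set, stated one-sidedly because the minorant only needs [f] not
    to drop by more than [e] nearby. *)
Lemma compact_unif_close (R : realType) (K : set (R * R)) (f : R * R -> R) (e : R) :
    compact K -> {within K, continuous f} -> 0 < e ->
  exists2 d : R, 0 < d & forall x y, K x -> K y -> dist1 x y < d -> f x - e < f y.
Proof.
move=> /compact_near_coveringP cK /subspace_continuousP cf e0.
pose P (d : R) x := K x -> forall y, K y -> dist1 x y < d -> f x - e < f y.
have : \forall d \near (0 : R)^'+, K `<=` P d.
  apply: cK => x Kx.
  have e20 : 0 < e / 2 by rewrite divr_gt0.
  have /cvgrPdist_lt/(_ _ e20) := cf x Kx.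
  rewrite /prop_near1 /within /= => /nbhs_ballP[r /= r0 xr].
  have r20 : 0 < r / 2 by rewrite divr_gt0.
  exists (ball x (r / 2), [set d | d < r / 2]) => /=.
    by split; [exact: nbhsx_ballx | exact: nbhs_right_lt].
  move=> [z d] [/= [xz1 xz2] dr] Kz y Ky zy.
  have /xr/(_ Kz) : ball x r z.
    have hr : r / 2 <= r by lra.
    by split; [exact: le_ball hr _ xz1 | exact: le_ball hr _ xz2].
  have /xr/(_ Ky) : ball x r y.
    move: xz1 xz2 zy; rewrite /ball /= /prod_ball /ball /= /dist1 => h1 h2 h3.
    have h4 := normr_ge0 (z.1 - y.1); have h5 := normr_ge0 (z.2 - y.2).
    have -> : x.1 - y.1 = (x.1 - z.1) + (z.1 - y.1) by ring.
    have -> : x.2 - y.2 = (x.2 - z.2) + (z.2 - y.2) by ring.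
    by split; apply: le_lt_trans (ler_normD _ _) _; lra.
  by rewrite /from_subspace !ltr_norml; lra.
move=> Pd; have : \forall d \near (0 : R)^'+, 0 < d /\ K `<=` P d.
  by apply: filterI Pd; exact: nbhs_right_gt.
move=> /filter_ex[d' [d0 Kd]]; exists d' => // x y Kx Ky; exact: Kd.
Qed.

Lemma lipschitz_minorant (R : realType) (K : set (R * R)) (f : R * R -> R) (e : R) :
    compact K -> K !=set0 -> {within K, continuous f} -> 0 < e ->
  exists p : R * R -> R, exists2 L : R, 0 < L &
    (forall x y, p x - p y <= L * dist1 x y) /\
    (forall x, K x -> p x <= f x <= p x + e).
Proof.
move=> cK [x0 Kx0] cf e0.
have [d d0 fd] := compact_unif_close cK cf e0.
have [M M0 fM] : exists2 M : R, 0 < M & forall x, K x -> `|f x| <= M.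
  have /compact_bounded[B [_ /(_ (`|B| + 1))]] := continuous_compact cf cK.
  move=> fB; exists (`|B| + 1) => [|x Kx]; first by rewrite ltr_wpDl.
  by apply: fB; [apply: le_lt_trans (ler_norm _) _; lra | exists x].
(* With this slope a point [y] at distance at least [d] costs at least [2 * M], which bounds
   [f x - f y]; nearer points are controlled by uniform continuity. *)
pose L : R := 2 * M / d; have L0 : 0 < L by rewrite divr_gt0 // mulr_gt0.
have d1_ge0 (x y : R * R) : 0 <= dist1 x y by rewrite addr_ge0.
have lbM x y : K y -> - M <= f y + L * dist1 x y.
  move=> /fM; rewrite ler_norml => /andP[h _].
  by have := mulr_ge0 (ltW L0) (d1_ge0 x y); lra.
pose p x := inf [set f y + L * dist1 x y | y in K].
have p_lb x : has_lbound [set f y + L * dist1 x y | y in K].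
  by exists (- M) => _ [y Ky <-]; exact: lbM.
exists p, L => //; split=> [x y|x Kx].
  rewrite lerBlDr -lerBlDl; apply: lb_le_inf; first by exists (f x0 + L * dist1 y x0), x0.
  move=> _ [z Kz <-]; rewrite lerBlDl.
  apply: (@le_trans _ _ (f z + L * dist1 x z)); first by apply: ge_inf => //; exists z.
  rewrite addrCA lerD2l -mulrDr ler_pM2l // /dist1.
  have -> : x.1 - z.1 = (x.1 - y.1) + (y.1 - z.1) by ring.
  have -> : x.2 - z.2 = (x.2 - y.2) + (y.2 - z.2) by ring.
  have := ler_normD (x.1 - y.1) (y.1 - z.1).
  by have := ler_normD (x.2 - y.2) (y.2 - z.2); lra.
apply/andP; split.
  apply: ge_inf => //; exists x => //.
  by rewrite /dist1 !subrr normr0 addr0 mulr0 addr0.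
rewrite -lerBlDr; apply: lb_le_inf; first by exists (f x0 + L * dist1 x x0), x0.
move=> _ [y Ky <-]; have [xy|xy] := ltP (dist1 x y) d.
  apply: le_trans (ltW (fd x y Kx Ky xy)) _.
  by rewrite lerDl; apply: mulr_ge0 => //; exact: ltW.
have : 2 * M <= L * dist1 x y 
  by rewrite /L -mulrA ler_peMr ?mulr_ge0 ?(ltW M0) // ler_pdivlMl // mulr1.
by have := fM x Kx; have := fM y Ky; rewrite !ler_norml; lra.
Qed.

(** * Image outer measures and planar area *)

Section outer_preimage.
Variables (R : realType) (T X : Type) (phi : X -> T).
Variable nu : {outer_measure set X -> \bar R}.

(** The pushforward of [nu] along [phi]. As an outer measure it applies to the arbitrary sets that
    occur in covers. *)
Definition outer_preimage (A : set T) : \bar R := nu (phi @^-1` A).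

Let outer_preimage0 : outer_preimage set0 = 0%E.
Proof. by rewrite /outer_preimage preimage_set0 outer_measure0. Qed.

Let outer_preimage_ge0 A : (0 <= outer_preimage A)%E.
Proof. exact: outer_measure_ge0. Qed.

Let le_outer_preimage : {homo outer_preimage : A B / A `<=` B >-> (A <= B)%E}.
Proof. by move=> A B AB; apply: le_outer_measure => x; exact: AB. Qed.

Let outer_preimage_sigma_subadditive : sigma_subadditive outer_preimage.
Proof.
by move=> F; rewrite /outer_preimage preimage_bigcup; exact: outer_measure_sigma_subadditive.
Qed.

HB.instance Definition _ := isOuterMeasure.Build R T outer_preimage
  outer_preimage0 outer_preimage_ge0 le_outer_preimage
  outer_preimage_sigma_subadditive.

End outer_preimage.

Section area.
Variable R : realType.

Definition area : {outer_measure set (R * R) -> \bar R} :=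
  [the {outer_measure set (measurableTypeR R * measurableTypeR R) -> \bar R}
    of mu_ext (lebesgue_measure \x lebesgue_measure)%E].

Lemma area_rect (a b c d : R) : a <= b -> c <= d ->
  area (rect a b c d) = ((b - a) * (d - c))%:E.
Proof.
move=> ab cd; rewrite /area /= measurable_mu_extE; last exact: measurableX.
rewrite [LHS](_ : _ = lebesgue_measure `[a, b] * lebesgue_measure `[c, d])%E;
  last exact: product_measure1E.
rewrite !lebesgue_measure_itv /= !lte_fin EFinM.
move: ab cd; rewrite !le_eqVlt => /predU1P[->|ab] /predU1P[->|cd];
  by rewrite ?ltxx ?ab ?cd ?subrr ?mule0 ?mul0e ?EFinB.
Qed.

End area.
Arguments area {R}.

(** * Area of the points where the zigzag is close to a given value *)

Section slice.
Variables (R : realType) (b : nat -> nat).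
Hypothesis b_steps : unit_steps b.
Hypothesis b_unbounded : forall m, exists n, (m <= b n)%N.
Local Notation h := (zigzag_fun R b).

(* The slice is resolved at the scale [k + n] where the range of a piece of [h]
   has shrunk to [3 ^- n]; [zigzag_label_window] counts the pieces. *)
Lemma area_slice_le (n : nat) (a y r C : R) (u0 : R) :
    0 <= u0 -> 0 < r <= (3 ^+ n)^-1 -> 0 <= C ->
  (area [set z : R * R | [/\ a <= z.1, `|z.1 - a - u0| <= r, `|z.2 - y| <= r &
      `|zigzag_fun b (z.1 - a) - zigzag_fun b u0| <= C * (3 ^+ n)^-1]]%R <=
   (6 * (2 * (Num.truncn C).+2).+1%:R * (3 ^+ b n * (3 ^+ n)^-1 ^+ 2 * r))%:E)%E.
Proof.
(* [Q] exceeds [C + 1]: the extra unit absorbs the rounding of values to labels. *)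
move=> u00 /andP[r0 rt] C0; set Q := (Num.truncn C).+2.
have [N bN] := unit_steps_surj b_steps b_unbounded n.
have nN : (n <= N)%N by rewrite -bN unit_steps_le.
move: (subnK nN) bN; move: (N - n)%N => k {N nN} <- bN.
set v0 := zigzag_label b (k + n) (cell (k + n) u0).
(* The window starts one cell before that of [u0] and spans three cells of level [n]. Where a
   subtraction truncates at 0, the window only reaches further up. *)
pose lo := (v0 - Q)%N; pose J := ((cell n u0).-1 * 3 ^ k)%N.
have p3 m : 0 < 3 ^+ m :> R by rewrite exprn_gt0.
pose win i := (lo <= zigzag_label b (k + n) (J + i) <= lo + 2 * Q)%N.
pose F i := if win i then
  rect (a + (J + i)%:R / 3 ^+ (k + n)) (a + (J + i).+1%:R / 3 ^+ (k + n))
       (y - r) (y + r) else set0.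
apply: (@le_trans _ _ (area (\big[setU/set0]_(i < 3 * 3 ^ k) F i))).
  apply: le_outer_measure => z [za z1 z2 zh].
  have u0' : 0 <= z.1 - a by rewrite subr_ge0.
  have cu : ((cell n u0).-1 <= cell n (z.1 - a) <= (cell n u0).+1)%N.
    have c1 : `|z.1 - a - u0| <= (3 ^+ n)^-1 by exact: le_trans rt.
    have c2 : `|u0 - (z.1 - a)| <= (3 ^+ n)^-1 by rewrite distrC.
    by have := cell_close c1; have := cell_close c2; clear; lia.
  have Jle : (J <= cell (k + n) (z.1 - a))%N.
    by rewrite /J -leq_divRL ?expn_gt0 // -cell_add; case/andP: cu.
  have iltm : (cell (k + n) (z.1 - a) - J < 3 * 3 ^ k)%N.
    rewrite ltn_subLR // /J -mulnDl -ltn_divLR ?expn_gt0 // -cell_add.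
    by move: cu; clear; lia.
  rewrite -bigcup_mkord; exists (cell (k + n) (z.1 - a) - J)%N => //=.
  rewrite /F /win subnKC // ifT; last first.
    have CQ : C < (Q.-1)%:R by exact: truncnS_gt.
    have QE : Q%:R = Q.-1%:R + 1 :> R by rewrite natr1.
    move: zh (zigzag_fun_itv b_steps (k + n) (z.1 - a)).
    move: (zigzag_fun_itv b_steps (k + n) u0); rewrite bN -/v0.
    move: (zigzag_label b _ _) (3 ^+ n) (p3 n) => v t t0.
    rewrite -[_.+1%:R]natr1 => + + +; rewrite -[_.+1%:R]natr1 ler_norml.
    rewrite !ler_pdivrMr // !ler_pdivlMr //.
    move: (zigzag_fun b u0) (zigzag_fun b (z.1 - a)) => h0 h1.
    move=> /andP[e3 e4] /andP[e1 e2] /andP[e5 e6].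
    have {e1} hm : - C <= (h1 - h0) * t by rewrite -ler_pdivrMr // mulNr.
    have vle : (v <= v0 + Q)%N.
      by rewrite -(ler_nat R) natrD; move: e2; rewrite mulrBl QE; lra.
    have vge : (v0 <= v + Q)%N.
      by rewrite -(ler_nat R) natrD; move: hm; rewrite mulrBl QE; lra.
    by move: vle vge; rewrite /lo; clear; lia.
  have := cell_itv (k + n) u0'; rewrite /rect !in_itv /= => /andP[i1 i2].
  move: z2; rewrite ler_norml => /andP[i3 i4]. split; rewrite /= in_itv /=; 
    apply/andP; split; lra.
apply: le_trans (outer_measure_subadditive _ _ _) _.
have areaF i : area (F i) = ((win i)%:R * ((3 ^+ (k + n))^-1 * (2 * r)))%:E.
  rewrite /F; case: (win i); last by rewrite outer_measure0 mul0r.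
  rewrite area_rect.
  - congr (_%:E); rewrite mulr1n mul1r; move: (J + i)%N (_^-1) => q w.
    by rewrite -[q.+1%:R]natr1; ring.
  - by rewrite lerD2l ler_pM2r ?invr_gt0 // ler_nat.
  - by lra.
under eq_bigr do rewrite areaF.
rewrite sumEFin lee_fin -mulr_suml -natr_sum.
(* The constant 6 is three cells times the height [2 * r] of a rectangle, up to [r]. *)
have := zigzag_label_window b_steps n k (cell n u0).-1 3 lo (2 * Q).
rewrite -/J big_mkord bN -(ler_nat R) !natrM !natrX.
rewrite -[\sum_(i < _) _]/(\sum_(i < 3 * 3 ^ k) (win i : nat))%N.
move: (\sum_(i < _) _)%N => cnt; rewrite exprD invfM.
move: (3 ^+ k) (3 ^+ n) (3 ^+ b n) (p3 k) (p3 n) => x t s x0 t0 hcnt.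
rewrite [leLHS](_ : _ = cnt%:R * t * (x^-1 * t^-1 ^+ 2 * 2 * r)); last by field; rewrite !gt_eqF.
apply: le_trans (ler_wpM2r _ hcnt) _.
  by rewrite !mulr_ge0 ?exprn_ge0 ?invr_ge0 ?ltW.
by rewrite le_eqVlt; apply/orP; left; apply/eqP; field; rewrite !gt_eqF.
Qed.

End slice.

(** * Graphs of Lipschitz functions minus a multiple of the zigzag *)

Definition graph_point (R : realType) (g : R * R -> R) (z : R * R) : 'rV[R]_3 :=
  \row_(i < 3) [:: z.1; z.2; g z]`_i.

Section graph_point.
Variables (R : realType) (g : R * R -> R).
Implicit Types (z w : R * R).

Lemma graph_point_close z w r : `|z.1 - w.1| <= r -> `|z.2 - w.2| <= r ->
  `|g z - g w| <= r -> edist (graph_point g z) (graph_point g w) <= 3 * r.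
Proof.
move=> h1 h2 h3; apply: edist_le_coord => i; rewrite !mxE.
by case: i => [[|[|[|//]]] ?].
Qed.

Lemma graph_point_coords z w r :
  edist (graph_point g z) (graph_point g w) <= r ->
  [/\ `|z.1 - w.1| <= r, `|z.2 - w.2| <= r & `|g z - g w| <= r].
Proof.
move=> zw; have hi i := le_trans (coord_le_edist _ _ i) zw.
have := hi (@Ordinal 3 0 isT); have := hi (@Ordinal 3 1 isT).
by have := hi (@Ordinal 3 2 isT); rewrite !mxE.
Qed.

Lemma preimage_graph_point (X : set (R * R)) :
  graph_point g @^-1` (graph X g) = X.
Proof.
apply/seteqP; split=> [z [w Xw wz]|z Xz]; last by exists z.
have {}wz : graph_point g w = graph_point g z := wz.
have [] := @graph_point_coords w z 0; first by rewrite wz edist_xx.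
rewrite !normr_le0 !subr_eq0 => /eqP e1 /eqP e2 _.
by move: Xw; rewrite [w]surjective_pairing e1 e2 -surjective_pairing.
Qed.

End graph_point.

Section zigzag_graph.
Variables (R : realType) (a b c d : R) (st : nat -> nat) (p : R * R -> R).
Variables (L del : R).
Hypothesis ab : a < b.
Hypothesis cd : c < d.
Hypothesis st_steps : unit_steps st.
Hypothesis st_unbounded : forall m, exists n, (m <= st n)%N.
Hypothesis p_lip : forall x y, p x - p y <= L * dist1 x y.
Hypothesis L_gt0 : 0 < L.
Hypothesis del_gt0 : 0 < del.

Definition zigzag_graph_fun (z : R * R) : R := p z - del * zigzag_fun st (z.1 - a).

Local Notation g := zigzag_graph_fun.
Local Notation X := (rect a b c d).
Local Notation G := (graph X g).

(** The mass distribution on the graph: the area of the part of the plane lying below a set. *)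
Definition graph_area : {outer_measure set 'rV[R]_3 -> \bar R} :=
  outer_preimage (graph_point g) area.

Lemma graph_area_full : graph_area G = ((b - a) * (d - c))%:E.
Proof.
rewrite /graph_area /= /outer_preimage preimage_graph_point.
by rewrite area_rect ?ltW.
Qed.

(** Over a set of diameter [r] the base point, the value of [g] and hence that of the zigzag vary by
    [O(r)]. With [3 ^- n.+1 < r <= 3 ^- n], [area_slice_le] gives area [O(3 ^ (st n - 3 * n))],
    which the bound on [st] turns into [O(r ^ s)]. *)
Lemma zigzag_graph_frostman s : 0 <= s ->
    (exists K : R, forall n, (st n)%:R <= (3 - s) * n%:R + K) ->
  exists2 k : R, 0 < k & forall U, (diam U <= 1%:E)%E ->
    (k%:E * graph_area (U `&` G) <= diam_pow s U)%E.
Proof.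
(* If [g] varies by at most [r] and [p] by at most [2 * L * r], the zigzag varies by at most
   [C * r]. *)
move=> s0 [K stK]; pose C := (1 + 2 * L) / del.
have C0 : 0 < C by rewrite divr_gt0 // addr_gt0 // mulr_gt0.
pose B : R := 6 * (2 * (Num.truncn C).+2).+1%:R * 3 `^ K * 3 `^ s.
have B0 : 0 < B by rewrite !mulr_gt0 ?powR_gt0 ?ltr0n.
exists B^-1 => [|U dU]; first by rewrite invr_gt0.
rewrite lee_pdivrMl // /graph_area /= /outer_preimage preimage_setI preimage_graph_point.
have [->|/set0P[z0 [/= Uz0 Xz0]]] := eqVneq (graph_point g @^-1` U `&` X) set0.
  by rewrite outer_measure0 mule_ge0 ?diam_pow_ge0 // lee_fin ltW.
have Une : U !=set0 by exists (graph_point g z0).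
move: dU (diam_ge0 U) (@edist_le_diam _ _ U); rewrite diam_pow_neq0 //.
case: (diam U) => [r|//|//]; rewrite !lee_fin => r1 r0 rU.
have zclose z : (graph_point g @^-1` U `&` X) z ->
    [/\ X z, `|z.1 - z0.1| <= r, `|z.2 - z0.2| <= r & `|g z - g z0| <= r].
  move=> [/= Uz Xz]; have := rU _ _ Uz Uz0; rewrite lee_fin.
  by move=> /graph_point_coords[].
(* A set of diameter 0 has no triadic scale; its preimage lies in a degenerate rectangle. *)
have [r_gt0|r_le0] := ltP 0 r; last first.
  rewrite (_ : area _ = 0%E); first by rewrite mule_ge0 ?poweR_ge0 // lee_fin ltW.
  apply/eqP; rewrite eq_le outer_measure_ge0 andbT.
  apply: (@le_trans _ _ (area (rect z0.1 z0.1 z0.2 z0.2))).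
    apply: le_outer_measure => z /zclose[_ h1 h2 _].
    move: (le_trans h1 r_le0) (le_trans h2 r_le0).
    rewrite !normr_le0 !subr_eq0 => /eqP e1 /eqP e2.
    by rewrite /rect /= !in_itv /= e1 e2 !lexx.
  by rewrite area_rect // !subrr mulr0.
have [||n] := @geometric_scale _ 3^-1 r 0 _ _.
- by rewrite invr_gt0 ltr0n invf_lt1 ?ltr0n // ltr1n.
- by rewrite r_gt0 expr0.
rewrite add0n !exprVn => /andP[rn1 rn].
have u00 : 0 <= z0.1 - a.
  by case: Xz0; rewrite /= !in_itv /= => /andP[h _] _; rewrite subr_ge0.
have rn' : 0 < r <= (3 ^+ n)^-1 by rewrite r_gt0.
apply: le_trans (le_trans (area_slice_le st_steps st_unbounded a z0.2 u00 rn' (ltW C0)) _).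
  apply: le_outer_measure => z /zclose[[/= Xz1 _] h1 h2 h3]; split=> //.
  - by move: Xz1; rewrite in_itv /= => /andP[].
  - by rewrite opprB addrA subrK.
  have dpos : 0 <= L * dist1 z z0 <= L * (2 * r).
    by rewrite ler_pM2l // mulr_ge0 ?addr_ge0 ?(ltW L_gt0) //= /dist1; lra.
  have d1C : dist1 z0 z = dist1 z z0.
    by rewrite /dist1 [in LHS]distrC; congr (_ + _); exact: distrC.
  have := p_lip z z0; have := p_lip z0 z; rewrite d1C => p1 p2.
  have : del * `|zigzag_fun st (z.1 - a) - zigzag_fun st (z0.1 - a)| <= (1 + 2 * L) * r.
    rewrite -{1}[del]gtr0_norm // -normrM; move: h3; rewrite /g !ler_norml.
    by move: p1 p2 dpos => ? ? /andP[? ?] /andP[? ?]; apply/andP; split; lra.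
  rewrite mulrC -ler_pdivlMr // => /le_trans; apply.
  by rewrite mulrAC -/C ler_pM2l.
rewrite poweR_EFin -EFinM lee_fin /B -!mulrA; do 2 rewrite ler_pM2l ?ltr0n //.
have t0 : 0 < (3 ^+ n)^-1 :> R by rewrite invr_gt0 exprn_gt0.
have st_le : 3 ^+ st n <= 3 `^ K * (3 ^+ n)^-1 `^ (s - 3).
  rewrite -powR_inv1 ?exprn_ge0 // -!powR_mulrn // -!powRrM -powRD ?pnatr_eq0 ?implybT //.
  by apply: ler_powR; [rewrite ler1n | have := stK n; lra].
apply: (@le_trans _ _ (3 `^ K * (3 ^+ n)^-1 `^ (s - 3) *
    ((3 ^+ n)^-1 * ((3 ^+ n)^-1 * r)))).
  by apply: ler_wpM2r => //; rewrite !mulr_ge0 ?(ltW t0).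
rewrite -mulrA ler_pM2l ?powR_gt0 //.
apply: (@le_trans _ _ ((3 ^+ n)^-1 `^ (s - 3) * (3 ^+ n)^-1 ^+ 3)).
  by rewrite ler_pM2l ?powR_gt0 // !exprS expr0 mulr1 !ler_pM2l.
rewrite -(powR_mulrn 3 (ltW t0)) -powRD ?(gt_eqF t0) ?implybT // subrK.
rewrite -powRM ?(ltW r_gt0) //; apply: ge0_ler_powR => //.
- by rewrite nnegrE ltW.
- by rewrite nnegrE mulr_ge0 // ltW.
- by move: rn1; rewrite exprS invfM ltr_pdivrMl // => /ltW.
Qed.

(** The Lipschitz part varies at scale [3 ^- m], which is at most [3 ^- st m] because
    [st m <= m]. *)
Lemma zigzag_graph_fun_close m z w : `|z.1 - w.1| <= (3 ^+ m)^-1 ->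
    `|z.2 - w.2| <= (3 ^+ m)^-1 ->
  `|g z - g w| <= (2 * L + 2 * del) / 3 ^+ st m.
Proof.
move=> h1 h2.
have h3 : `|zigzag_fun st (z.1 - a) - zigzag_fun st (w.1 - a)| <= 2 / 3 ^+ st m.
  by apply: zigzag_fun_close => //; rewrite opprB addrA subrK.
have h4 : (3 ^+ m)^-1 <= (3 ^+ st m)^-1 :> R.
  rewrite lef_pV2 ?posrE ?exprn_gt0 // ler_weXn2l ?ler1n //.
  exact: unit_steps_le.
have dw : L * dist1 z w <= L * (2 * (3 ^+ st m)^-1).
  by rewrite ler_pM2l // /dist1; lra.
have d1C : dist1 w z = dist1 z w.
  by rewrite /dist1 [in LHS]distrC; congr (_ + _); exact: distrC.
have hdel : del * `|zigzag_fun st (z.1 - a) - zigzag_fun st (w.1 - a)| <=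
  del * (2 / 3 ^+ st m) by rewrite ler_pM2l //; exact: h3.
have := p_lip z w; have := p_lip w z; rewrite d1C => p1 p2.
move: hdel; rewrite -{1}[del]gtr0_norm // -normrM /g !ler_norml.
by move=> /andP[? ?]; apply/andP; split; lra.
Qed.

(** Over each of the [O(3 ^ (2 * m))] base squares of side [3 ^- m] the graph has height
    [O(3 ^- st m)], so [O(3 ^ (m - st m))] cubes cover it. The lower bound on [st] makes the total
    [O(3 ^ (m * beta))]. *)
Lemma zigzag_graph_box_count beta : 0 <= beta ->
    (forall n, (3 - beta) * n%:R - 1 <= (st n)%:R) ->
  box_count_le G beta.
Proof.
move=> beta0 st_ge; pose E := 2 * L + 2 * del.
have E0 : 0 < E by rewrite addr_gt0 ?mulr_gt0.
pose K := (b - a + 1) * (d - c + 1) * (2 * E + 1).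
have K0 : 0 < K.
  have : 0 < b - a by rewrite subr_gt0. have : 0 < d - c by rewrite subr_gt0.
  by move=> ? ?; rewrite !mulr_gt0 //; lra.
exists (3 * K * 9 `^ beta) => [|r /andP[r0 r1]].
  by rewrite mulr_gt0 ?powR_gt0 // pmulr_rgt0.
(* The scale is taken for [r / 3] since points with coordinates within [3 ^- m] are at distance at
   most [3 * 3 ^- m]. *)
have [||n] := @geometric_scale _ 3^-1 (r / 3) 0 _ _.
- by rewrite invr_gt0 ltr0n invf_lt1 ?ltr0n // ltr1n.
- by rewrite divr_gt0 // expr0; lra.
rewrite add0n !exprVn => /andP[rn1 rn].
have r9 : r <= 9 * (3 ^+ n.+1)^-1.
  by move: rn; rewrite exprS invfM; move: (3 ^+ n)^-1 => u; lra.
have {rn1 rn} rn : 3 * (3 ^+ n.+1)^-1 <= r by lra.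
move: n.+1 rn r9 => m rn r9; have t0 : 0 < 3 ^+ m :> R by rewrite exprn_gt0.
have s0 : 0 < 3 ^+ st m :> R by rewrite exprn_gt0.
have st_m : 3 ^+ st m <= 3 ^+ m :> R.
  by rewrite ler_weXn2l ?ler1n //; exact: unit_steps_le.
pose Jx := (Num.truncn (3 ^+ m * (b - a))).+1.
pose Jy := (Num.truncn (3 ^+ m * (d - c))).+1.
pose Jz := (Num.truncn (3 ^+ m * (2 * E / 3 ^+ st m))).+1.
pose corner (j l : nat) := (a + j%:R / 3 ^+ m, c + l%:R / 3 ^+ m).
(* Height relative to the corner, shifted to be nonnegative so that [cell] locates it. *)
pose slab z j l := g z - g (corner j l) + E / 3 ^+ st m.
pose V (i : 'I_Jx * 'I_Jy * 'I_Jz) := graph_point g @` [set z | [/\ X z,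
  cell m (z.1 - a) = i.1.1, cell m (z.2 - c) = i.1.2 &
  cell m (slab z i.1.1 i.1.2) = i.2]].
have Xge z : X z -> 0 <= z.1 - a /\ 0 <= z.2 - c.
  by rewrite /rect /= !in_itv /= !subr_ge0 => -[/andP[-> _] /andP[-> _]].
have slab_itv z : X z -> 0 <= slab z (cell m (z.1 - a)) (cell m (z.2 - c)) <= 2 * E / 3 ^+ st m.
  move=> /Xge[zx zy]; rewrite /slab; set w := corner _ _.
  have : `|g z - g w| <= E / 3 ^+ st m.
    by apply: zigzag_graph_fun_close; rewrite /w /corner /= opprD addrA;
      exact: cell_left_close.
  by rewrite ler_norml => /andP[h1 h2]; apply/andP; split; lra.
exists #|{: 'I_Jx * 'I_Jy * 'I_Jz}|; split; last first.
  exists (V \o enum_val); split=> [i|_ [z Xz <-]] /=.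
    apply: diam_le => [|_ _ [z [Xz z1 z2 z3] <-] [w [Xw w1 w2 w3] <-]]; first exact: ltW.
    have [zx zy] := Xge z Xz; have [wx wy] := Xge w Xw.
    apply: le_trans rn; apply: graph_point_close.
    - have -> : z.1 - w.1 = (z.1 - a) - (w.1 - a) by ring.
      by apply: cell_eq_close => //; rewrite z1.
    - have -> : z.2 - w.2 = (z.2 - c) - (w.2 - c) by ring.
      by apply: cell_eq_close => //; rewrite z2.
    - have -> : g z - g w = slab z (enum_val i).1.1 (enum_val i).1.2 -
        slab w (enum_val i).1.1 (enum_val i).1.2 by rewrite /slab; ring.
      have := slab_itv z Xz; have := slab_itv w Xw; rewrite z1 z2 w1 w2.
      by move=> /andP[? _] /andP[? _]; apply: cell_eq_close => //; rewrite z3.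
  have [zx zy] := Xge z Xz; have /andP[sl0 sl1] := slab_itv z Xz.
  have jx : (cell m (z.1 - a) < Jx)%N.
    rewrite ltnS; apply: le_truncn; rewrite ler_pM2l // lerD2r.
    by case: Xz; rewrite /= !in_itv /= => /andP[].
  have jy : (cell m (z.2 - c) < Jy)%N.
    rewrite ltnS; apply: le_truncn; rewrite ler_pM2l // lerD2r.
    by case: Xz; rewrite /= !in_itv /= => _ /andP[].
  have jz : (cell m (slab z (cell m (z.1 - a)) (cell m (z.2 - c))) < Jz)%N.
    by rewrite ltnS; apply: le_truncn; rewrite ler_pM2l.
  exists (enum_rank (Ordinal jx, Ordinal jy, Ordinal jz)) => //=.
  by rewrite enum_rankK; exists z.
rewrite !card_prod !card_ord !natrM.
have trunc_le (x : R) : 0 <= x -> (Num.truncn x).+1%:R <= x + 1.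
  by move=> x0; rewrite -natr1 lerD2r truncn_le.
have T1 : 1 <= 3 ^+ m :> R by rewrite exprn_ege1 // ler1n.
have TS1 : 1 <= 3 ^+ m / 3 ^+ st m :> R by rewrite ler_pdivlMr // mul1r.
have ba : 0 < b - a by rewrite subr_gt0.
have dc : 0 < d - c by rewrite subr_gt0.
have Jx_le : Jx%:R <= 3 ^+ m * (b - a + 1).
  by apply: le_trans (trunc_le _ _) _; [rewrite mulr_ge0 ?ltW | rewrite mulrDr; lra].
have Jy_le : Jy%:R <= 3 ^+ m * (d - c + 1).
  by apply: le_trans (trunc_le _ _) _; [rewrite mulr_ge0 ?ltW | rewrite mulrDr; lra].
have Jz_le : Jz%:R <= (2 * E + 1) * (3 ^+ m / 3 ^+ st m).
  have -> : (2 * E + 1) * (3 ^+ m / 3 ^+ st m) =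
    3 ^+ m * (2 * E / 3 ^+ st m) + 3 ^+ m / 3 ^+ st m by ring.
  apply: le_trans (trunc_le _ _) _; last by rewrite lerD2l.
  by rewrite !mulr_ge0 ?invr_ge0 ?(ltW E0) ?(ltW s0) ?(ltW t0).
apply: (@le_trans _ _ (K * ((3 ^+ m) ^+ 3 / 3 ^+ st m))).
  have -> : K * ((3 ^+ m) ^+ 3 / 3 ^+ st m) = 3 ^+ m * (b - a + 1) *
    (3 ^+ m * (d - c + 1)) * ((2 * E + 1) * (3 ^+ m / 3 ^+ st m)).
    by rewrite /K; field; rewrite gt_eqF.
  by apply: ler_pM => //; apply: ler_pM.
have -> : 3 * K * 9 `^ beta * r `^ (- beta) = K * (3 * (9 `^ beta * r `^ (- beta))).
  by ring.
rewrite ler_pM2l //.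
have SL : 3 ^+ st m >= 3^-1 * (3 ^+ m) `^ (3 - beta).
  rewrite -[3^-1]powR_inv1 // -!powR_mulrn // -!powRrM -powRD ?pnatr_eq0 ?implybT //.
  by apply: ler_powR; [rewrite ler1n | have := st_ge m; lra].
have T3 : (3 ^+ m) ^+ 3 = (3 ^+ m) `^ beta * (3 ^+ m) `^ (3 - beta) :> R.
  by rewrite -powRD ?(gt_eqF t0) ?implybT // addrCA subrr addr0 powR_mulrn // ltW.
apply: (@le_trans _ _ (3 * (3 ^+ m) `^ beta)).
  rewrite ler_pdivrMr // T3 -mulrA mulrCA ler_pM2l ?powR_gt0 //.
  by rewrite -ler_pdivrMl.
rewrite ler_pM2l // powRN ler_pdivlMr ?powR_gt0 // -powRM ?(ltW t0) ?(ltW r0) //.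
apply: ge0_ler_powR; rewrite ?nnegrE ?mulr_ge0 ?(ltW t0) ?(ltW r0) //.
by rewrite mulrC -ler_pdivlMr.
Qed.

Lemma zigzag_graph_fun_continuous : continuous g.
Proof.
move=> z; apply/cvgrPdist_le => e e0; pose E := 2 * L + 2 * del.
have E0 : 0 < E by rewrite addr_gt0 ?mulr_gt0.
have [||k ke] := @exists_expr_lt _ 3^-1 (e / E) _ _.
- by rewrite invr_ge0 ler0n invf_lt1 ?ltr0n // ltr1n.
- by rewrite divr_gt0.
(* However slowly [st] grows, being unbounded it makes the modulus [3 ^- st n] tend to 0. *)
have [n kn] := st_unbounded k.
have n0 : 0 < (3 ^+ n)^-1 :> R by rewrite invr_gt0 exprn_gt0.
apply: filterS (nbhsx_ballx z _ n0) => w [/= /ltW w1 /ltW w2].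
apply: le_trans (zigzag_graph_fun_close w1 w2) _.
rewrite -/E mulrC -ler_pdivlMr //; apply: le_trans (ltW ke).
by rewrite exprVn lef_pV2 ?posrE ?exprn_gt0 // ler_weXn2l ?ler1n.
Qed.

Lemma zigzag_graph_dim D beta : 0 < beta ->
    (forall n, (3 - beta) * n%:R - 1 <= (st n)%:R) ->
    (forall e, 0 < e -> exists K : R, forall n,
      (st n)%:R <= (3 - beta + e) * n%:R + K) ->
  has_dim D G beta.
Proof.
move=> beta0 st_ge st_le; apply: (@has_dim_of_frostman _ _ _ _ graph_area) => //.
- exists ((b - a) * (d - c)); first by rewrite mulr_gt0 // subr_gt0.
  by rewrite graph_area_full.
- move=> s /andP[s0 sb]; apply: zigzag_graph_frostman => //.
  have [|K stK] := st_le (beta - s); first by rewrite subr_gt0.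
  by exists K => n; rewrite (_ : 3 - s = 3 - beta + (beta - s)) //; ring.
- by apply: zigzag_graph_box_count => //; exact: ltW.
Qed.

End zigzag_graph.

(** * Approximation from below *)

Theorem theorem2p9 (R : realType) (D : dimension) (a b c d beta : R)
    (f : R * R -> R) (hab : a < b) (hcd : c < d) (hbeta : 2 <= beta <= 3)
    (hf : continuous_functions (rect a b c d) f) :
  forall eps : R, 0 < eps ->
    exists g : R * R -> R,
      [/\ graph_dim_class D (rect a b c d) beta g,
          forall x, rect a b c d x -> g x <= f x &
          sup_norm (rect a b c d) (f \- g) < eps].
Proof.
move=> eps eps0; have [beta2 beta3] := andP hbeta.
have [|st [st_steps st_unbounded st_ge st_le]] :=
  @exists_unit_steps_rate R (3 - beta); first by apply/andP; split; lra.
have Xne : rect a b c d !=set0.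
  by exists (a, c); rewrite /rect /= !in_itv /= !lexx !ltW.
have cX : compact (rect a b c d) by apply: compact_setX; exact: segment_compact.
have eps4 : 0 < eps / 4 by rewrite divr_gt0.
have [p [L L0 [p_lip pf]]] := lipschitz_minorant cX Xne hf eps4.
have w0 : 0 < b - a + 1 by lra.
(* The zigzag is at most [b - a + 1] on the rectangle, so each of the two errors is at most
   [eps / 4]; their sum [eps / 2] leaves room for the strict inequality on the supremum. *)
pose del := eps / 4 / (b - a + 1); have del0 : 0 < del by rewrite divr_gt0.
have h_itv x : rect a b c d x -> 0 <= zigzag_fun st (x.1 - a) <= b - a + 1.
  rewrite /rect /= !in_itv /= => -[/andP[xa xb] _].
  (* At level 0 a unit cell is its own label, so the zigzag exceeds its argument by at most 1. *)
  have := zigzag_fun_itv st_steps 0 (x.1 - a).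
  rewrite st_steps.1 expr0 !divr1 => /andP[h0 h1]; apply/andP; split.
    exact: le_trans h0.
  apply: le_trans h1 _; rewrite /zigzag_label /= /cell expr0 mul1r -natr1 lerD2r.
  by apply: le_trans (_ : x.1 - a <= _); [rewrite truncn_le subr_ge0 | rewrite lerD2r].
exists (zigzag_graph_fun a st p del); split.
- split; first by apply: continuous_subspaceT; exact: zigzag_graph_fun_continuous p_lip L0 del0.
  by apply: (zigzag_graph_dim (L := L)) => //; lra.
- move=> x Xx; have /andP[h0 _] := h_itv x Xx; have /andP[px _] := pf x Xx.
  by rewrite /zigzag_graph_fun lerBlDr (le_trans px) // lerDl mulr_ge0 // ltW.
- apply: (@le_lt_trans _ _ (eps / 2)); last by lra.
  apply: ge_sup; first by case: Xne => x Xx; exists `|(f \- zigzag_graph_fun a st p del) x|, x.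
  move=> _ [x Xx <-] /=; have /andP[h0 h1] := h_itv x Xx.
  have /andP[p0 p1] := pf x Xx.
  have dh0 : 0 <= del * zigzag_fun st (x.1 - a) by rewrite mulr_ge0 // ltW.
  have dh1 : del * zigzag_fun st (x.1 - a) <= eps / 4.
    by rewrite /del mulrAC ler_pdivrMr // ler_pM2l.
  by rewrite /zigzag_graph_fun ger0_norm; lra.
Qed.
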